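(* Each of the following properties of a group pair $(G,\mathcal{P})$ is a geometric property of group pairs: (1) $\mathcal{P}$ has finite height in $G$. (2) $\mathcal{P}$ has finite width in $G$. (3) $\mathcal{P}$ has fenced infinite intersections in $G$. (4) $\mathcal{P}$ is an almost malnormal collection in $G$. (5) $G$ is a network with respect to $\mathcal{P}$. (6) $G$ is thick of order $1$ (that is, the pair $(G,\mathcal{P})$ is thick of order $1$). (7) Every $P\in\mathcal{P}$ satisfies $P=\mathrm{Comm}_G(P)$. (8) Every $P\in\mathcal{P}$ has finite index in $\mathrm{Comm}_G(P)$. (9) $\mathcal{P}$ has bounded packing in $G$. (10) $\mathcal{P}$ has finite packing in $G$.
   Context: A group pair $(G,\mathcal{P})$ is a finitely generated group $G$ together with a finite collection $\mathcal{P}$ of infinite subgroups of $G$. $G$ carries a fixed word metric $\mathrm{dist}_G$ with respect to a finite generating set; $\mathrm{dist}_G(A,B)$ is the infimum distance between subsets, $\mathrm{hdist}_G$ the Hausdorff distance (possibly $\infty$), and $\mathcal{N}_r(A)$ the closed $r$-neighborhood of $A$. $G/\mathcal{P}$ is the set of all left cosets $gP$, $g\in G$, $P\in\mathcal{P}$. Quasi-isometric pairs: $(G,\mathcal{P})$ and $(H,\mathcal{Q})$ are quasi-isometric if there are a quasi-isometry $q\colon G\to H$ and $M>0$ such that every $q(A)$ with $A\in G/\mathcal{P}$ is at Hausdorff distance $<M$ from some $B\in H/\mathcal{Q}$, and every $B\in H/\mathcal{Q}$ is at Hausdorff distance $<M$ from $q(A)$ for some $A\in G/\mathcal{P}$.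 Virtually isomorphic pairs: $(G,\mathcal{P})$ and $(H,\mathcal{Q})$ are virtually isomorphic if one can transform one into the other by a finite sequence of the following operations and their inverses: (i) replace $\mathcal{P}$ by a finite collection $\mathcal{Q}$ of subgroups of $G$ such that each $Q\in\mathcal{Q}$ is commensurable to a conjugate of some $P\in\mathcal{P}$ and vice versa (two subgroups are commensurable if their intersection has finite index in both); (ii) replace $(G,\mathcal{P})$ by $(G/N,\{PN/N: P\in\mathcal{P}\})$ with $N$ a finite normal subgroup of $G$; (iii) replace $(G,\mathcal{P})$ by $(H,\mathcal{Q})$ where $H\le G$ has finite index and $\mathcal{Q}=\{g_iP_ig_i^{-1}\cap H: i\in I\}$, with $\{g_iP_i: i\in I\}$ a set of representatives of the orbits of the left multiplication action of $H$ on $G/\mathcal{P}$. Geometric property: a property $\mathbb{P}$ of group pairs is geometric if every group pair that is quasi-isometric to some pair satisfying $\mathbb{P}$ is virtually isomorphic to some pair satisfying $\mathbb{P}$. Finite height: there is a finite bound on the $m$ for which there exist $m$ distinct cosets $g_1P_1,\dots,g_mP_m\in G/\mathcal{P}$ with $\bigcap_{i=1}^m g_iP_ig_i^{-1}$ infinite. Finite width: there is a finite bound on the $m$ for which there exist $m$ distinct cosets $g_1P_1,\dots,g_mP_m\in G/\mathcal{P}$ with $g_iP_ig_i^{-1}\cap g_jP_jg_j^{-1}$ infinite for all $i<j$. Fenced infinite intersections: there is $\tau\ge0$ such that $\mathrm{dist}_G(g_1P_1,g_2P_2)\le\tau$ whenever $g_1P_1,g_2P_2\in G/\mathcal{P}$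 and $g_1P_1g_1^{-1}\cap g_2P_2g_2^{-1}$ is infinite. Almost malnormal: for all $P,P'\in\mathcal{P}$ and $g\in G$, either $gPg^{-1}\cap P'$ is finite, or $P=P'$ and $g\in P$. Network: a metric space $X$ is a $\tau$-network ($\tau\ge0$) with respect to a collection $\mathcal{L}$ of subsets if $X=\bigcup_{L\in\mathcal{L}}\mathcal{N}_\tau(L)$ and for all $L,L'\in\mathcal{L}$ there is a sequence $L=L_1,\dots,L_n=L'$ in $\mathcal{L}$ with $\mathcal{N}_\tau(L_i)\cap\mathcal{N}_\tau(L_{i+1})$ unbounded for all $i$. $G$ is a network with respect to $\mathcal{P}$ if $\mathcal{P}\neq\emptyset$ and $(G,\mathrm{dist}_G)$ is a $\tau$-network with respect to $G/\mathcal{P}$ for some $\tau\ge0$. Thickness: a collection $\mathcal{Y}$ of metric spaces is uniformly thick of order $0$ if it is uniformly unconstricted in the sense of Behrstock, Druţu and Mosher, that is: (a) there is a constant $c\ge0$ such that every point of every $Y\in\mathcal{Y}$ is at distance at most $c$ from a bi-infinite geodesic in $Y$; and (b) every sequence of spaces in $\mathcal{Y}$ has an asymptotic cone without a cut-point, meaning that for every sequence of spaces $(Y_i,\mathrm{dist}_i)$ in $\mathcal{Y}$ there exist a non-principal ultrafilter $\omega$ and scaling constants $d_i\to\infty$ such that for every choice of basepoints $b_i\in Y_i$ the ultralimit $\lim_\omega(Y_i,b_i,\frac1{d_i}\mathrm{dist}_i)$ has no cut-points. A single space is thick of order $0$ if the collection consisting of it is uniformly thick of order $0$. A space $X$ is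 thick of order at most $1$ with respect to a collection $\mathcal{Y}$ of subspaces if for some $\tau\geq 0$, $X$ is a $\tau$-network with respect to $\mathcal{Y}$ and each $Y\in\mathcal{Y}$ with the subspace metric is thick of order $0$; it is thick of order $1$ if moreover $X$ is not thick of order $0$. The pair $(G,\mathcal{P})$ is thick of order $1$ if $(G,\mathrm{dist}_G)$ is thick of order $1$ with respect to $G/\mathcal{P}$. Commensurator: $\mathrm{Comm}_G(P)=\{g\in G: P\cap gPg^{-1}\text{ has finite index in both }P\text{ and }gPg^{-1}\}$. Bounded packing: for each constant $D$ there is $N$ such that among any $N$ distinct cosets in $G/\mathcal{P}$ at least two are at distance at least $D$ in $(G,\mathrm{dist}_G)$. Finite packing: there is a finite subset $D\subset G/\mathcal{P}$ such that for any finite subset $\{g_1P_1,\dots,g_dP_d\}$ of $G/\mathcal{P}$ with $\bigcap_{i=1}^d g_iP_ig_i^{-1}$ infinite there is $g\in G$ with $gg_iP_i\in D$ for every $i$.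
   Formalization: In (6), condition (a) of uniformly unconstricted asks for bi-infinite quasi-geodesics with uniform constants instead of bi-infinite geodesics, since word metrics on G and its cosets are discrete and contain no real geodesic lines. *)

(* Defs.v *)
From HB Require Import structures.
From Stdlib Require Import Relation_Operators.
From mathcomp Require Import all_boot all_order all_algebra.
From mathcomp Require Import all_classical all_reals all_analysis.

Set Implicit Arguments.
Unset Strict Implicit.
Unset Printing Implicit Defensive.

Import Order.TTheory GRing.Theory Num.Theory.
Import numFieldNormedType.Exports.
Local Open Scope classical_set_scope.
Local Open Scope quotient_scope.
Local Open Scope ring_scope.

Section Metric.
Context {R : realType}.

Definition set_dist (X : metricType R) (A B : set X) : \bar R :=
  ereal_inf [set (mdist x y)%:E | x in A & y in B].

Definition nbhd (X : metricType R) (r : R) (A : set X) : set X :=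
  [set x | (set_dist [set x] A <= r%:E)%E].

Definition hausdorff_dist (X : metricType R) (A B : set X) : \bar R :=
  ereal_inf [set r%:E | r in
    [set r : R | [/\ 0 <= r, A `<=` nbhd r B & B `<=` nbhd r A]]].

Definition unbounded (X : metricType R) (A : set X) : Prop :=
  ~ exists K : R, forall x y, A x -> A y -> mdist x y <= K.

Definition quasi_isometry (X Y : metricType R) (q : X -> Y) : Prop :=
  exists L C : R, [/\ 1 <= L, 0 <= C,
    forall x x', mdist x x' / L - C <= mdist (q x) (q x') <= L * mdist x x' + C
  & forall y, exists x, mdist (q x) y <= C].

Definition biinfinite_quasigeodesic (L C : R) (X : metricType R) (f : R -> X) :
    Prop :=
  forall s t, `|s - t| / L - C <= mdist (f s) (f t) <= L * `|s - t| + C.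

Definition tau_network (X : metricType R) (tau : R) (F : set (set X)) : Prop :=
  [set: X] = \bigcup_(A in F) nbhd tau A /\
  forall A B, F A -> F B -> exists (n : nat) (c : nat -> set X),
    [/\ c 0%N = A, c n = B, forall i, (i <= n)%N -> F (c i) &
        forall i, (i < n)%N ->
          unbounded (nbhd tau (c i) `&` nbhd tau (c i.+1))].

End Metric.

Section Subspace.
Context {R : realType} {X : metricType R} (A : set X).

Let sub_dist (x y : set_type A) : R := mdist (\val x) (\val y).

Let sub_dist_ge0 x y : 0 <= sub_dist x y.
Proof. exact: mdist_ge0. Qed.

Let sub_dist_eq0 x y : sub_dist x y = 0 -> x = y.
Proof. by move=> /mdist_positivity /val_inj. Qed.

Let sub_ball x d : ball x d = [set y | sub_dist x y < d].
Proof.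
have -> : ball x d = [set y | ball (\val x) d (\val y)] by [].
by rewrite ballEmdist.
Qed.

HB.instance Definition _ := @PseudoMetric_isMetric.Build R (set_type A)
  sub_dist sub_dist_ge0 sub_dist_eq0 sub_ball.

End Subspace.

Record nonprincipal_ultrafilter := NonprincipalUltrafilter {
  ultra_sets :> set_system nat;
  ultra_setsP : UltraFilter ultra_sets;
  ultra_nonprincipal : forall n, ~ ultra_sets [set n]
}.
#[export] Existing Instance ultra_setsP.

Section Ultralimit.
Context {R : realType}.
Variables (w : nonprincipal_ultrafilter) (Y : nat -> metricType R).
Variables (b : forall i, Y i) (d : nat -> {posnum R}).

Record ultraseq := Ultraseq {
  ultraseq_fun :> forall i, Y i;
  ultraseq_bounded : exists K : R,
    \forall i \near ultra_sets w, mdist (ultraseq_fun i) (b i) / (d i)%:num <= K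
}.

HB.instance Definition _ := gen_eqMixin ultraseq.
HB.instance Definition _ := gen_choiceMixin ultraseq.

Definition ultraseq_dist (x y : ultraseq) : R :=
  lim ((fun i => mdist (x i) (y i) / (d i)%:num) @ ultra_sets w).

Lemma ultraseq_dist_cvg (x y : ultraseq) :
  (fun i => mdist (x i) (y i) / (d i)%:num) @ ultra_sets w -->
  ultraseq_dist x y.
Proof.
have [K1 H1] := ultraseq_bounded x; have [K2 H2] := ultraseq_bounded y.
set f := fun i => _; apply/cvg_ex.
have fF : UltraFilter (f @ ultra_sets w).
  split; first exact: fmap_proper_filter.
  move=> G GF fG; apply/seteqP; split => // B GB.
  have [//|nB] := in_ultra_setVsetC (f @^-1` B) (ultra_setsP w).
  have /fG GnB : (f @ ultra_sets w) (~` B) by [].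
  by case: (@filter_not_empty _ G _); rewrite -(setICr B); exact: filterI.
have f_in : \forall i \near ultra_sets w, `[0, K1 + K2]%classic (f i).
  near=> i; rewrite /= in_itv /= /f; apply/andP; split.
    by rewrite divr_ge0 // mdist_ge0.
  apply: (@le_trans _ _ (mdist (x i) (b i) / (d i)%:num +
                         mdist (y i) (b i) / (d i)%:num)).
    by rewrite -mulrDl ler_pM2r // (metric_sym (y i)) metric_triangle.
  by apply: lerD; near: i.
have := @segment_compact R 0 (K1 + K2); rewrite compact_ultra.
by move=> /(_ _ fF f_in) [l [_ fl]]; exists l.
Unshelve. all: by end_near. Qed.

Arguments ultraseq_dist_cvg : clear implicits.

Let dist_ge0 x y : 0 <= ultraseq_dist x y.
Proof.
apply: (cvgr_to_ge (ultraseq_dist_cvg x y)).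
by apply: nearW => i; rewrite divr_ge0 // mdist_ge0.
Qed.

Let dist_xx x : ultraseq_dist x x = 0.
Proof.
rewrite /ultraseq_dist (_ : (fun i => _) = cst 0); first by rewrite lim_cst.
by apply/funext => i; rewrite mdistxx mul0r.
Qed.

Let dist_sym x y : ultraseq_dist x y = ultraseq_dist y x.
Proof.
rewrite /ultraseq_dist; under eq_fun do rewrite metric_sym.
by [].
Qed.

Let dist_triangle y x z :
  ultraseq_dist x z <= ultraseq_dist x y + ultraseq_dist y z.
Proof.
apply: (ler_cvg_to (ultraseq_dist_cvg x z)
  (cvgD (ultraseq_dist_cvg x y) (ultraseq_dist_cvg y z))).
by apply: nearW => i /=; rewrite -mulrDl ler_pM2r // metric_triangle.
Qed.

Definition ultraseq_eq (x y : ultraseq) : bool := ultraseq_dist x y == 0.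

Let eq_refl : reflexive ultraseq_eq.
Proof. by move=> x; rewrite /ultraseq_eq dist_xx. Qed.

Let eq_sym : symmetric ultraseq_eq.
Proof. by move=> x y; rewrite /ultraseq_eq dist_sym. Qed.

Let eq_trans : transitive ultraseq_eq.
Proof.
move=> y x z /eqP xy /eqP yz; apply/eqP/le_anti; rewrite dist_ge0 andbT.
by rewrite (le_trans (dist_triangle y x z)) // xy yz addr0.
Qed.

Canonical ultraseq_equiv := EquivRel ultraseq_eq eq_refl eq_sym eq_trans.

Definition ultralimit : Type := {eq_quot ultraseq_equiv}.

HB.instance Definition _ := Choice.on ultralimit.

Definition ultralimit_dist (p q : ultralimit) : R :=
  ultraseq_dist (repr (p : {eq_quot ultraseq_equiv}))
                (repr (q : {eq_quot ultraseq_equiv})).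

Let limit_xx p : ultralimit_dist p p = 0.
Proof. exact: dist_xx. Qed.

Let limit_eq0 p q : ultralimit_dist p q = 0 -> p = q.
Proof.
move=> pq; rewrite -[p](@reprK _ {eq_quot ultraseq_equiv}).
rewrite -[q](@reprK _ {eq_quot ultraseq_equiv}).
by apply/eqmodP/eqP.
Qed.

Let limit_sym p q : ultralimit_dist p q = ultralimit_dist q p.
Proof. exact: dist_sym. Qed.

Let limit_triangle q p r :
  ultralimit_dist p r <= ultralimit_dist p q + ultralimit_dist q r.
Proof. exact: dist_triangle. Qed.

HB.instance Definition _ := isMetric.Build R ultralimit
  limit_xx limit_eq0 limit_sym limit_triangle.

End Ultralimit.

(** On a connected space this is the usual notion.  A disconnected space with at
    least three points always has a cut-point in this sense. *)
Definition cut_point (T : topologicalType) (x : T) : Prop :=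
  ~ connected (~` [set x]).

Section Thick.
Context {R : realType}.

(** The spaces of interest are word metrics and their restrictions to cosets.
    They are discrete, so they contain no isometric copy of the real line, and
    whether they contain an isometric copy of the integers depends on the
    generating set (the even integers, as a subspace of the integers with
    generator 1, contain none).  Hence the bi-infinite geodesics of the
    unconstrictedness condition are taken in the coarse sense: quasi-geodesics
    with constants uniform over the family. *)
Definition uniformly_unconstricted (F : metricType R -> Prop) : Prop :=
  (exists L C c : R, [/\ 1 <= L, 0 <= C, 0 <= c &
     forall Y : metricType R, F Y -> forall y : Y,
       exists2 f : R -> Y, biinfinite_quasigeodesic L C f & nbhd c (range f) y])
  /\
  (forall Y : nat -> metricType R, (forall i, F (Y i)) ->
     exists (w : nonprincipal_ultrafilter) (d : nat -> {posnum R}),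
       (fun i => (d i)%:num) @ \oo --> +oo /\
       forall (b : forall i, Y i) (x : ultralimit w b d), ~ cut_point x).

Definition thick0 (X : metricType R) : Prop :=
  uniformly_unconstricted (fun Y => Y = X).

Definition thick_le1 (X : metricType R) (F : set (set X)) : Prop :=
  (exists2 tau : R, 0 <= tau & tau_network tau F) /\
  forall A : set X, F A -> thick0 (set_type A).

Definition thick1 (X : metricType R) (F : set (set X)) : Prop :=
  thick_le1 F /\ ~ thick0 X.

End Thick.

Section Words.
Context {G : groupType}.
Local Open Scope group_scope.

Definition word_product (S : seq G) (n : nat) (x : G) : Prop :=
  exists2 u : seq G, size u = n /\ all (fun s => (s \in S) || (s^-1 \in S)) u &
    x = \prod_(s <- u) s.

End Words.

Record fgGroup := FgGroup {
  fg_sort :> groupType;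
  fg_gens : seq fg_sort;
  fg_gensP : forall x, exists n, word_product fg_gens n x
}.

Section WordMetric.
Variable G : fgGroup.
Local Open Scope group_scope.

Lemma word_length_subproof (x : G) :
  exists n, `[< word_product (fg_gens G) n x >].
Proof. by have [n xn] := fg_gensP x; exists n; apply/asboolP. Qed.

Definition word_length (x : G) : nat := ex_minn (word_length_subproof x).

Lemma word_lengthP x : word_product (fg_gens G) (word_length x) x.
Proof. by rewrite /word_length; case: ex_minnP => n /asboolP. Qed.

Lemma word_length_le n x :
  word_product (fg_gens G) n x -> (word_length x <= n)%N.
Proof.
by move=> xn; rewrite /word_length; case: ex_minnP => m _; apply; apply/asboolP.
Qed.

Lemma word_length1 : word_length 1 = 0%N.
Proof.
by apply/eqP; rewrite -leqn0 word_length_le //; exists [::]; rewrite ?big_nil.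
Qed.

Lemma word_length_eq0 x : word_length x = 0%N -> x = 1.
Proof.
move=> x0; have := word_lengthP x; rewrite x0 => -[u [/size0nil -> _] ->].
by rewrite big_nil.
Qed.

Lemma word_lengthM x y :
  (word_length (x * y) <= word_length x + word_length y)%N.
Proof.
have [u [su au] xu] := word_lengthP x; have [v [sv av] yv] := word_lengthP y.
apply: word_length_le; exists (u ++ v); last by rewrite xu yv big_cat.
by rewrite size_cat su sv all_cat au av.
Qed.

Lemma word_length_inv_le x : (word_length x^-1 <= word_length x)%N.
Proof.
have [u [su au] xu] := word_lengthP x; apply: word_length_le.
exists (rev (map (fun s : G => s^-1) u)).
  rewrite size_rev size_map su all_rev all_map; split => //.
  by apply: sub_all au => s /=; rewrite invgK orbC.
rewrite xu; elim: u {su au xu} => [|s u IH]; first by rewrite !big_nil invg1.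
by rewrite big_cons invgM /= rev_cons -cats1 big_cat big_seq1 IH.
Qed.

Lemma word_lengthV x : word_length x^-1 = word_length x.
Proof.
by apply/eqP; rewrite eqn_leq word_length_inv_le -{1}[x]invgK word_length_inv_le.
Qed.

End WordMetric.

(** [cayley R G] is [G] with the word metric of the generating set carried by
    [G]. *)
Definition cayley (R : realType) (G : fgGroup) : Type := G.

Section Cayley.
Variables (R : realType) (G : fgGroup).

HB.instance Definition _ := Choice.copy (cayley R G) (fg_sort G).

Definition word_dist (x y : cayley R G) : R :=
  (word_length ((x : G)^-1 * (y : G))%g)%:R.

Let word_distxx x : word_dist x x = 0.
Proof. by rewrite /word_dist mulVg word_length1. Qed.

Let word_dist_eq0 x y : word_dist x y = 0 -> x = y.
Proof.
move=> /eqP; rewrite pnatr_eq0 => /eqP /word_length_eq0 xy.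
by rewrite -[LHS](@mulg1 G) -xy mulVKg.
Qed.

Let word_dist_sym x y : word_dist x y = word_dist y x.
Proof. by rewrite /word_dist -word_lengthV invgM invgK. Qed.

Let word_dist_triangle y x z : word_dist x z <= word_dist x y + word_dist y z.
Proof.
rewrite /word_dist -natrD ler_nat (leq_trans _ (word_lengthM _ _)) //.
by rewrite -mulgA mulVKg.
Qed.

HB.instance Definition _ := isMetric.Build R (cayley R G)
  word_distxx word_dist_eq0 word_dist_sym word_dist_triangle.

End Cayley.

Section Subgroups.
Context {G : groupType}.
Local Open Scope group_scope.

Definition lcos (g : G) (P : set G) : set G := [set g * x | x in P].

Definition conj_set (g : G) (P : set G) : set G := [set g * x * g^-1 | x in P].

(** [H] is meant to be a subgroup of [K]. *)
Definition finite_index (H K : set G) : Prop :=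
  finite_set [set lcos g H | g in K].

Definition commensurable (A B : set G) : Prop :=
  finite_index (A `&` B) A /\ finite_index (A `&` B) B.

Definition commensurator (P : set G) : set G :=
  [set g | commensurable P (conj_set g P)].

End Subgroups.

Record peripheral (G : groupType) := Peripheral {
  per_set : set (set G);
  per_finite : finite_set per_set;
  per_subgroup : forall P, per_set P -> group_closed [in P];
  per_infinite : forall P, per_set P -> infinite_set P
}.

Record group_pair := GroupPair {
  gp_group :> fgGroup;
  gp_peripheral : peripheral gp_group
}.

Definition gp_per (A : group_pair) : set (set A) := per_set (gp_peripheral A).
Arguments gp_per : clear implicits.

(** [G/P]: since the collection is a set of subgroups, a coset is determined by
    its underlying set. *)
Definition cosets (A : group_pair) : set (set A) :=
  [set C | exists g P, gp_per A P /\ C = lcos g P].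
Arguments cosets : clear implicits.

Definition quasi_isometric (R : realType) (A B : group_pair) : Prop :=
  exists (q : cayley R A -> cayley R B) (M : R),
    [/\ quasi_isometry q, 0 < M,
        forall C : set (cayley R A), cosets A C ->
          exists2 D : set (cayley R B), cosets B D &
            (hausdorff_dist (q @` C) D < M%:E)%E
      & forall D : set (cayley R B), cosets B D ->
          exists2 C : set (cayley R A), cosets A C &
            (hausdorff_dist (q @` C) D < M%:E)%E].

(** Quotients and subgroups are taken up to isomorphism: a quotient by a finite
    normal subgroup [N] is a surjective morphism with kernel [N], and a subgroup
    is the range of an injective morphism. *)
Inductive vi_step : group_pair -> group_pair -> Prop :=
| vi_commensurable (G : fgGroup) (P Q : peripheral G) :
    (forall B, per_set Q B -> exists A g, per_set P A /\ commensurable B (conj_set g A)) ->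
    (forall A, per_set P A -> exists B g, per_set Q B /\ commensurable A (conj_set g B)) ->
    vi_step (GroupPair P) (GroupPair Q)
| vi_quotient (A B : group_pair) (f : {multiplicative A -> B}) :
    range f = [set: B] ->
    finite_set [set x | f x = 1%g] ->
    gp_per B = [set f @` P | P in gp_per A] ->
    vi_step A B
| vi_finite_index (A B : group_pair) (f : {multiplicative B -> A})
    (I : Type) (g : I -> A) (P : I -> set A) :
    injective f ->
    finite_index (range f) [set: A] ->
    (forall i, gp_per A (P i)) ->
    (forall C, cosets A C ->
       exists! i, exists h : B, C = lcos (f h) (lcos (g i) (P i))) ->
    gp_per B = range (fun i => f @^-1` conj_set (g i) (P i)) ->
    vi_step A B.

Definition virtually_isomorphic : group_pair -> group_pair -> Prop :=
  clos_refl_sym_trans group_pair vi_step.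

Definition geometric_property (R : realType) (Pr : group_pair -> Prop) : Prop :=
  forall A B, quasi_isometric R A B -> Pr A ->
    exists2 C, virtually_isomorphic B C & Pr C.

Section Properties.
Implicit Type A : group_pair.
Local Open Scope group_scope.

Definition finite_height A : Prop :=
  exists N : nat, forall (m : nat) (g : 'I_m -> A) (P : 'I_m -> set A),
    (forall i, gp_per A (P i)) ->
    injective (fun i => lcos (g i) (P i)) ->
    infinite_set (\bigcap_i conj_set (g i) (P i)) ->
    (m <= N)%N.

Definition finite_width A : Prop :=
  exists N : nat, forall (m : nat) (g : 'I_m -> A) (P : 'I_m -> set A),
    (forall i, gp_per A (P i)) ->
    injective (fun i => lcos (g i) (P i)) ->
    (forall i j : 'I_m, (i < j)%N ->
       infinite_set (conj_set (g i) (P i) `&` conj_set (g j) (P j))) ->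
    (m <= N)%N.

Definition fenced_infinite_intersections (R : realType) A : Prop :=
  exists2 tau : R, (0 <= tau)%R &
    forall (g1 g2 : A) (P1 P2 : set A), gp_per A P1 -> gp_per A P2 ->
      infinite_set (conj_set g1 P1 `&` conj_set g2 P2) ->
      (set_dist (lcos g1 P1 : set (cayley R A)) (lcos g2 P2) <= tau%:E)%E.

Definition almost_malnormal A : Prop :=
  forall (P P' : set A) (g : A), gp_per A P -> gp_per A P' ->
    finite_set (conj_set g P `&` P') \/ (P = P' /\ P g).

Definition network (R : realType) A : Prop :=
  gp_per A !=set0 /\
  exists2 tau : R, (0 <= tau)%R &
    tau_network tau (cosets A : set (set (cayley R A))).

Definition thick_of_order1 (R : realType) A : Prop :=
  thick1 (cosets A : set (set (cayley R A))).

Definition self_commensurating A : Prop :=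
  forall P : set A, gp_per A P -> P = commensurator P.

Definition finite_index_in_commensurator A : Prop :=
  forall P : set A, gp_per A P -> finite_index P (commensurator P).

Definition bounded_packing (R : realType) A : Prop :=
  forall D : R, exists N : nat, forall C : 'I_N -> set (cayley R A),
    (forall i, cosets A (C i)) -> injective C ->
    exists i j, i <> j /\ (D%:E <= set_dist (C i) (C j))%E.

Definition finite_packing A : Prop :=
  exists D : set (set A),
    [/\ D `<=` cosets A, finite_set D &
        forall (n : nat) (g : 'I_n -> A) (P : 'I_n -> set A),
          (forall i, gp_per A (P i)) ->
          infinite_set (\bigcap_i conj_set (g i) (P i)) ->
          exists x : A, forall i, D (lcos x (lcos (g i) (P i)))].

End Properties.

(* Main.v *)
(** Two cosets (or finitely many) have stabilisers with infinite intersection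
    exactly when suitable neighbourhoods of them have unbounded intersection,
    and their stabilisers are commensurable exactly when they are at finite
    Hausdorff distance.  Both right-hand sides are preserved by a quasi-isometry
    of pairs [q], which matches each coset [D] of [B] with a coset [C] of [A].
    The matching need not be injective, but only boundedly many [D] share the
    same [C], because only finitely many cosets meet a given ball.  This makes
    every property except almost malnormality and self-commensuration invariant
    under quasi-isometry.  For these two, the finite index of [P] in its
    commensurator is invariant, and one replaces the subgroups of [B] by the
    commensurators of representatives of suitable classes.  For thickness, a
    quasi-isometry induces a bi-Lipschitz bijection of ultralimits. *)
Require Import Defs.
From mathcomp Require Import all_boot all_order all_algebra.
From mathcomp Require Import all_classical all_reals all_analysis.
From mathcomp Require Import lra.

Set Implicit Arguments.
Unset Strict Implicit.
Unset Printing Implicit Defensive.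

Import Order.TTheory GRing.Theory Num.Theory.
Import numFieldNormedType.Exports.
Local Open Scope classical_set_scope.
Local Open Scope ring_scope.

(** * Neighbourhoods, finite Hausdorff distance, and quasi-isometries with a single constant *)

Section Tubes.
Context {R : realType}.
Implicit Types X Y : metricType R.

(** [nbhd] bounds an infimum that need not be attained, whereas a tube supplies an actual point of
    [A]. Passing from [nbhd] to [tube] costs an arbitrarily small increase of the radius. *)
Definition tube X (r : R) (A : set X) : set X :=
  [set x | exists2 a, A a & mdist x a <= r].

Lemma set_dist_le X (A B : set X) x y r :
  A x -> B y -> mdist x y <= r -> (set_dist A B <= r%:E)%E.
Proof.
move=> Ax By xyr; apply: ge_ereal_inf; exists (mdist x y)%:E => //.
by exists x => //; exists y.
Qed.

Lemma set_dist_lt X (A B : set X) r : (set_dist A B < r%:E)%E ->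
  exists x y, [/\ A x, B y & mdist x y < r].
Proof.
move=> /ereal_inf_lt[_ [x Ax [y By <-]]]; rewrite lte_fin => xyr.
by exists x, y.
Qed.

Lemma set_dist_le_lt X (A B : set X) r s : r < s -> (set_dist A B <= r%:E)%E ->
  exists x y, [/\ A x, B y & mdist x y < s].
Proof. by move=> rs ABr; apply/set_dist_lt/(le_lt_trans ABr). Qed.

Lemma tube_nbhd X r (A : set X) : tube r A `<=` nbhd r A.
Proof. by move=> x [a Aa xa]; apply: set_dist_le Aa xa. Qed.

Lemma nbhd_tube X r s (A : set X) : r < s -> nbhd r A `<=` tube s A.
Proof. by move=> rs x /(set_dist_le_lt rs)[_ [a [-> Aa /ltW]]]; exists a. Qed.

Lemma sub_tube X r s (A : set X) : r <= s -> tube r A `<=` tube s A.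
Proof. by move=> rs x [a Aa xa]; exists a => //; apply: le_trans xa rs. Qed.

Lemma tube_tube X r s (A B : set X) :
  A `<=` tube r B -> tube s A `<=` tube (s + r) B.
Proof.
move=> AB x [a /AB[b Bb ab] xa]; exists b => //.
by rewrite (le_trans (metric_triangle _ a _)) // lerD.
Qed.

Lemma unbounded_sub X (A B : set X) : A `<=` B -> unbounded A -> unbounded B.
Proof.
move=> AB uA [K BK]; apply: uA; exists K => x y Ax Ay.
by apply: BK; apply: AB.
Qed.

(** Finite Hausdorff distance. For cosets this is the metric form of commensurability of
    stabilisers. *)
Definition coarse_eq X (A B : set X) : Prop :=
  exists r, A `<=` tube r B /\ B `<=` tube r A.

Lemma coarse_eq_refl X (A : set X) : coarse_eq A A.
Proof. by exists 0; split=> x Ax; exists x; rewrite ?mdistxx. Qed.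

Lemma coarse_eq_sym X (A B : set X) : coarse_eq A B -> coarse_eq B A.
Proof. by move=> [r [AB BA]]; exists r. Qed.

Lemma coarse_eq_trans X (A B C : set X) :
  coarse_eq A B -> coarse_eq B C -> coarse_eq A C.
Proof.
move=> [r [AB BA]] [s [BC CB]]; exists (r + s); split=> x.
  by move=> /AB; apply: tube_tube BC x.
by move=> /CB; rewrite addrC; apply: tube_tube BA x.
Qed.

Section QuasiIsometries.
Variables (X Y : metricType R) (K : R) (q : X -> Y).

(** A single constant serves all estimates, and the lower bound is multiplied out, so that later
    estimates are polynomial inequalities without division. *)
Definition quasi_isometry_const : Prop :=
  [/\ 1 <= K,
      forall x x', mdist (q x) (q x') <= K * mdist x x' + K,
      forall x x', mdist x x' <= K * mdist (q x) (q x') + K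
    & forall y, exists x, mdist (q x) y <= K].

Definition matched (C : set X) (D : set Y) : Prop :=
  (forall c, C c -> exists2 d, D d & mdist (q c) d <= K) /\
  (forall d, D d -> exists2 c, C c & mdist (q c) d <= K).

End QuasiIsometries.

Lemma hausdorff_matched X Y (q : X -> Y) M C D :
  (hausdorff_dist (q @` C) D < M%:E)%E -> matched M q C D.
Proof.
move=> /ereal_inf_lt[_ [r [r0 CD DC] <-]]; rewrite lte_fin => rM; split.
  move=> c Cc; have /CD : (q @` C) (q c) by exists c.
  exact: (nbhd_tube rM).
move=> d /DC /(nbhd_tube rM)[_ [c Cc <-]]; rewrite metric_sym.
by exists c.
Qed.

Lemma matched_le X Y (q : X -> Y) M K C D :
  M <= K -> matched M q C D -> matched K q C D.
Proof.
move=> MK [CD DC]; split.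
  by move=> c /CD[d Dd cd]; exists d => //; apply: le_trans MK.
by move=> d /DC[c Cc cd]; exists c => //; apply: le_trans MK.
Qed.

(** Multiplying the lower estimate by [L] turns its error into [L * C]. Allowing every larger [K]
    lets this constant be merged with the Hausdorff bound of a quasi-isometry of pairs. *)
Lemma quasi_isometryP X Y (q : X -> Y) : quasi_isometry q ->
  exists K0, forall K, K0 <= K -> quasi_isometry_const K q.
Proof.
move=> [L [C [L1 C0 qd qs]]]; exists (L + L * C) => K LK.
have LC0 : 0 <= L * C by rewrite mulr_ge0 // (le_trans ler01).
have CLC : C <= L * C by rewrite ler_peMl.
split=> [|x x'|x x'|y].
- lra.
- have /andP[_] := qd x x'; have := mdist_ge0 x x'; nra.
- have /andP[+ _] := qd x x'.
  rewrite lerBlDr ler_pdivrMr; last by lra.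
  have := mdist_ge0 (q x) (q x'); nra.
- by have [x qx] := qs y; exists x; lra.
Qed.

Section QuasiIsometryTheory.
Variables (X Y : metricType R) (K : R) (q : X -> Y).
Hypothesis qK : quasi_isometry_const K q.

(** Any choice of near-preimages is a quasi-inverse. It serves to carry thickness of order 0
    backwards, from the target to the source. *)
Lemma quasi_isometry_inverse :
  exists (K' : R) (p : Y -> X), quasi_isometry_const K' p.
Proof.
have [K1 qu ql /choice[p pK]] := qK.
exists (2 * K ^+ 2 + 3 * K), p; split=> [|y y'|y y'|x].
- by nra.
- have := ql (p y) (p y').
  have : mdist (q (p y)) (q (p y')) <= K + mdist y y' + K.
    rewrite (le_trans (metric_triangle _ y _)) // -addrA lerD //.
    rewrite (le_trans (metric_triangle _ y' _)) // lerD //.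
    by rewrite metric_sym.
  have := mdist_ge0 y y'; nra.
- have := qu (p y) (p y').
  have : mdist y y' <= K + mdist (q (p y)) (q (p y')) + K.
    rewrite (le_trans (metric_triangle _ (q (p y)) _)) // -addrA lerD //.
      by rewrite metric_sym.
    by rewrite (le_trans (metric_triangle _ (q (p y')) _)) // lerD.
  have := mdist_ge0 (p y) (p y'); nra.
- exists (q x); apply: le_trans (ql _ _) _; have := pK (q x).
  have := mdist_ge0 (q (p (q x))) (q x); nra.
Qed.

End QuasiIsometryTheory.

Lemma matched_dist X Y K (q : X -> Y) c c' d d' :
  quasi_isometry_const K q -> mdist (q c) d <= K -> mdist (q c') d' <= K ->
  mdist c c' <= K * (mdist d d' + 2 * K) + K.
Proof.
move=> [K1 _ ql _] cd cd'; apply: le_trans (ql _ _) _; rewrite lerD2r.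
rewrite ler_pM2l; last by lra.
rewrite (le_trans (metric_triangle _ d _)) //.
rewrite metric_sym in cd'; have := metric_triangle d d' (q c'); lra.
Qed.

Lemma matched_dist_image X Y K (q : X -> Y) c c' d d' :
  quasi_isometry_const K q -> mdist (q c) d <= K -> mdist (q c') d' <= K ->
  mdist d d' <= K * mdist c c' + 3 * K.
Proof.
move=> [K1 qu _ _] cd cd'; have := qu c c'; rewrite metric_sym in cd.
have := metric_triangle d (q c) d'; have := metric_triangle (q c) (q c') d'.
lra.
Qed.

Lemma matched_coarse X Y K (q : X -> Y) C D D' :
  matched K q C D -> matched K q C D' -> coarse_eq D D'.
Proof.
have H E E' : matched K q C E -> matched K q C E' -> E `<=` tube (K + K) E'.
  move=> [_ EC] [CE' _] d /EC[c /CE'[d' D'd' cd'] cd]; exists d' => //.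
  rewrite metric_sym in cd.
  by rewrite (le_trans (metric_triangle _ (q c) _)) // lerD.
by move=> CD CD'; exists (K + K); split; [apply: H CD CD' | apply: H CD' CD].
Qed.

Lemma coarse_matched X Y K (q : X -> Y) C C' D D' :
  quasi_isometry_const K q -> matched K q C D -> matched K q C' D' ->
  coarse_eq D D' -> coarse_eq C C'.
Proof.
move=> qK.
have H r E E' F F' : matched K q E F -> matched K q E' F' -> F `<=` tube r F' ->
    E `<=` tube (K * (r + 2 * K) + K) E'.
  move=> [EF _] [_ FE'] FF' c /EF[d /FF'[d' /FE'[c' Ec' cd'] dd'] cd].
  exists c' => //; apply: le_trans (matched_dist qK cd cd') _.
  by rewrite lerD2r ler_pM2l ?lerD2r //; case: qK => *; lra.
move=> CD CD' [r [DD' D'D]]; exists (K * (r + 2 * K) + K).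
by split; [apply: H CD CD' DD' | apply: H CD' CD D'D].
Qed.

(** A choice [p] of near-preimages sends the intersection of the tubes about the [D i] into that of
    larger tubes about the [C i]. Were the latter bounded, so would be the former. The constants do
    not depend on [i], hence the arbitrary index type. *)
Lemma unbounded_pull X Y K (q : X -> Y) J (C : J -> set X) (D : J -> set Y) r :
  quasi_isometry_const K q -> (forall i, matched K q (C i) (D i)) ->
  unbounded (\bigcap_i tube r (D i)) ->
  exists s, unbounded (\bigcap_i tube s (C i)).
Proof.
move=> qK CD uD; have [K1 _ _ /choice[p pK]] := qK.
exists (K * (r + 2 * K) + K) => -[B CB]; apply: uD.
exists (K * B + 3 * K) => y y' Dy Dy'.
have pC z : (\bigcap_i tube r (D i)) z ->
    (\bigcap_i tube (K * (r + 2 * K) + K) (C i)) (p z).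
  move=> Dz i _; have [d Dd zd] := Dz i I.
  have [_ /(_ d Dd)[c Cc cd]] := CD i; exists c => //.
  apply: le_trans (matched_dist qK (pK z) cd) _.
  by rewrite lerD2r ler_pM2l ?lerD2r //; lra.
apply: le_trans (matched_dist_image qK (pK y) (pK y')) _.
by rewrite lerD2r ler_pM2l; [apply: CB; apply: pC | lra].
Qed.

(** The new radius is explicit because a network needs one radius for all links of all chains. *)
Lemma unbounded_push X Y K (q : X -> Y) J (C : J -> set X) (D : J -> set Y) r :
  quasi_isometry_const K q -> (forall i, matched K q (C i) (D i)) ->
  unbounded (\bigcap_i tube r (C i)) ->
  unbounded (\bigcap_i tube (K * r + 2 * K) (D i)).
Proof.
move=> qK CD uC [B DB]; apply: uC; have [K1 qu ql _] := qK.
have qD z : (\bigcap_i tube r (C i)) z ->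
    (\bigcap_i tube (K * r + 2 * K) (D i)) (q z).
  move=> Cz i _; have [c Cc zc] := Cz i I.
  have [/(_ c Cc)[d Dd cd] _] := CD i; exists d => //.
  rewrite (le_trans (metric_triangle _ (q c) _)) //.
  have := qu z c; nra.
exists (K * B + K) => x x' Cx Cx'; apply: le_trans (ql _ _) _.
by rewrite lerD2r ler_pM2l; [apply: DB; apply: qD | lra].
Qed.

End Tubes.

(** * Cosets in a finitely generated group *)

Section Finiteness.

Lemma infinite_fiber (T : Type) (F : finType) (f : T -> F) (U : set T) :
  infinite_set U -> exists t, infinite_set (U `&` f @^-1` [set t]).
Proof.
move=> Uoo; apply: contrapT => /forallNP Ufin; apply: Uoo.
have -> : U = \bigcup_(t in [set: F]) (U `&` f @^-1` [set t]).
  by apply/seteqP; split=> [x Ux|x [t _ []//]]; exists (f x).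
by apply: bigcup_finite => // t _; apply: contrapT; apply: Ufin.
Qed.

Lemma finite_set_bounded (T : Type) (f : T -> nat) (U : set T) :
  finite_set U -> exists n, forall x, U x -> (f x <= n)%N.
Proof.
move=> /(finite_image f)/finite_seqP[s fUs].
exists (\max_(i <- s) i)%N => x Ux.
have fxs : [set` s] (f x) by rewrite -fUs; exists x.
exact: (@leq_bigmax_seq _ s xpredT id).
Qed.

Lemma infinite_nonempty (T : Type) (U : set T) : infinite_set U -> U !=set0.
Proof.
move=> Uoo; apply/set0P/eqP => U0; apply: Uoo.
by rewrite U0; apply: finite_set0.
Qed.

End Finiteness.

Section Subgroups.
Context {G : groupType}.
Local Open Scope group_scope.
Implicit Types (g h : G) (P Q : set G).

Lemma subgroup1 P : group_closed [in P] -> P 1.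
Proof. by case=> /set_mem. Qed.

Lemma subgroup_div P : group_closed [in P] ->
  forall x y, P x -> P y -> P (x * y^-1).
Proof.
by move=> [_ PP] x y /mem_set Px /mem_set Py; apply: set_mem; apply: PP.
Qed.

Lemma subgroupV P : group_closed [in P] -> forall x, P x -> P x^-1.
Proof.
move=> gP x Px; rewrite -[x^-1]mul1g.
by apply: subgroup_div => //; apply: subgroup1.
Qed.

Lemma subgroupM P : group_closed [in P] ->
  forall x y, P x -> P y -> P (x * y).
Proof.
move=> gP x y Px Py; rewrite -[y]invgK.
by apply: subgroup_div => //; apply: subgroupV.
Qed.

Lemma is_subgroup P : P 1 -> (forall x y, P x -> P y -> P (x * y^-1)) ->
  group_closed [in P].
Proof.
move=> P1 PP; split; first exact: mem_set.
by move=> x y /set_mem Px /set_mem Py; apply/mem_set/PP.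
Qed.

Lemma lcosP g P x : lcos g P x <-> P (g^-1 * x).
Proof.
split=> [[p Pp <-]|Pgx]; first by rewrite mulKg.
by exists (g^-1 * x) => //; rewrite mulVKg.
Qed.

Lemma lcos_lcos g h P : lcos g (lcos h P) = lcos (g * h) P.
Proof.
apply/seteqP; split=> x.
  by move=> [_ [p Pp <-] <-]; exists p; rewrite // mulgA.
by move=> [p Pp <-]; exists (h * p); [exists p | rewrite mulgA].
Qed.

Lemma lcos1 P : lcos 1 P = P.
Proof.
apply/seteqP; split=> x; first by move=> [p Pp <-]; rewrite mul1g.
by exists x; rewrite ?mul1g.
Qed.

Lemma lcos_mem g P x : group_closed [in P] -> lcos g P x -> lcos g P = lcos x P.
Proof.
move=> gP [p Pp <-]; rewrite -lcos_lcos; congr lcos.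
apply/seteqP; split=> y; last by move=> [z Pz <-]; apply: subgroupM.
move=> Py; exists (p^-1 * y); rewrite ?mulVKg //.
by apply: subgroupM => //; apply: subgroupV.
Qed.

Lemma conj_setP g P x : conj_set g P x <-> P (g^-1 * x * g).
Proof.
split=> [[p Pp <-]|Pgx]; first by rewrite -!mulgA mulVg mulg1 mulKg.
by exists (g^-1 * x * g) => //; rewrite !mulgA mulgV mul1g mulgK.
Qed.

Lemma conj_set1 P : conj_set 1 P = P.
Proof.
by apply/seteqP; split=> x; rewrite conj_setP invg1 mul1g mulg1.
Qed.

Lemma conj_set_subgroup g P : group_closed [in P] ->
  group_closed [in conj_set g P].
Proof.
move=> gP; apply: is_subgroup.
  by apply/conj_setP; rewrite mulg1 mulVg; apply: subgroup1.
move=> _ _ [x Px <-] [y Py <-]; exists (x * y^-1); first exact: subgroup_div.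
by rewrite !invgM invgK !mulgA mulgVK.
Qed.

End Subgroups.

(** * Coarse geometry of cosets in the word metric *)

Section CayleyGeometry.
Context {R : realType} {G : fgGroup}.
Local Notation dist := (@mdist R (cayley R G)).
Local Notation tube := (@tube R (cayley R G)).
Local Notation coarse_eq := (@coarse_eq R (cayley R G)).
Local Notation unbounded := (@unbounded R (cayley R G)).
Implicit Types (g h x y u : G) (C D P Q : set G).

Lemma dist_mull g x y : dist (g * x)%g (g * y)%g = dist x y.
Proof.
by rewrite /mdist /= /word_dist invgM -mulgA (mulgA g^-1%g) mulVg mul1g.
Qed.

Lemma dist_mulr x u : dist x (x * u)%g = (word_length u)%:R.
Proof. by rewrite /mdist /= /word_dist mulKg. Qed.

Lemma distE x y : dist x y = (word_length (x^-1 * y)%g)%:R.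
Proof. by []. Qed.

Lemma finite_word_ball (n : nat) : finite_set [set x : G | (word_length x <=
  n)%N].
Proof.
pose W k := [set x : G | word_product (fg_gens G) k x].
have Wfin k : finite_set (W k).
  elim: k => [|k IH].
    apply: (@sub_finite_set _ _ [set 1%g]) => // x [u [/size0nil-> _] ->].
    by rewrite big_nil.
  pose S := [set s : G | (s \in fg_gens G) || (s^-1%g \in fg_gens G)].
  have Sfin : finite_set S.
    apply/finite_seqP;
    exists (fg_gens G ++ map (fun s : G => s^-1%g) (fg_gens G)).
    apply/seteqP; split=> s /=; rewrite mem_cat.
      move=> /orP[->//|s1]; apply/orP; right; apply/mapP.
      by exists s^-1%g => //; rewrite invgK.
    move=> /orP[s1|/mapP[t tS ->]]; rewrite /S /= ?s1 // invgK tS.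
    by rewrite orbT.
  apply: sub_finite_set (finite_image2 (fun x y : G => (x * y)%g) Sfin IH).
  move=> x [[|s u] [//= [su] /andP[sS uS]] ->]; exists s => //.
  by exists (\prod_(t <- u) t)%g; rewrite ?big_cons //; exists u.
apply: (@sub_finite_set _ _ (\bigcup_(k in `I_n.+1) W k)); last first.
  by apply: bigcup_finite => //; apply: finite_II.
by move=> x xn; exists (word_length x) => //; apply: word_lengthP.
Qed.

Lemma finite_ball r : finite_set [set x : G | (word_length x)%:R <= r :> R].
Proof.
have [r0|r0] := ltP r 0.
  apply: (@sub_finite_set _ _ set0) => // x /= xr.
  by have := lt_le_trans r0 (ler0n R (word_length x)); lra.
apply: sub_finite_set (finite_word_ball (Num.truncn r)) => x /= xr.
by rewrite truncn_ge_nat.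
Qed.

(** Balls of the word metric are finite. This links the metric conditions on tubes with the
    algebraic ones on intersections of subgroups. *)
Lemma unbounded_infinite C : unbounded C <-> infinite_set C.
Proof.
split.
  move=> uC finC; apply: uC.
  have [n nC] := finite_set_bounded (fun x : G => word_length x) finC.
  exists (n%:R + n%:R) => x y Cx Cy; rewrite distE -natrD ler_nat.
  rewrite (leq_trans (word_lengthM _ _)) // word_lengthV.
  by apply: leq_add; apply: nC.
move=> Coo [K CK]; apply: (Coo).
have [x Cx] := infinite_nonempty Coo.
apply: sub_finite_set (finite_image (fun u => (x * u)%g) (finite_ball K)) =>
  y Cy.
by exists (x^-1 * y)%g; rewrite ?mulVKg //=; apply: CK.
Qed.

Lemma lcos_tube g r C D : C `<=` tube r D -> lcos g C `<=` tube r (lcos g D).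
Proof.
move=> CD _ [c /CD[d Dd cd] <-]; exists (g * d)%g; first by exists d.
by rewrite dist_mull.
Qed.

Lemma coarse_eq_lcos g C D : coarse_eq C D -> coarse_eq (lcos g C) (lcos g D).
Proof. by move=> [r [CD DC]]; exists r; split; apply: lcos_tube. Qed.

(** The conjugate is the coset translated on the right by the inverse of [g], and this right
    translation moves every point by exactly [word_length g]. *)
Lemma coarse_eq_conj g P : coarse_eq (conj_set g P) (lcos g P).
Proof.
exists (word_length g)%:R; split=> [_ [p Pp <-]|_ [p Pp <-]].
  exists (g * p)%g; first by exists p.
  by rewrite -[X in dist _ X](mulgVK g) dist_mulr.
exists (g * p * g^-1)%g; first by exists p.
by rewrite dist_mulr word_lengthV.
Qed.

(* For the converse: a left coset of [P `&` Q] in [P] is the trace on [P] of a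
   left coset of [Q] that meets the ball of radius [r] about the identity. *)
Lemma finite_index_tube P Q : group_closed [in P] -> group_closed [in Q] ->
  finite_index (P `&` Q) P <-> exists r, P `<=` tube r Q.
Proof.
move=> gP gQ; split.
  (* Choose one point in each of the finitely many cosets and bound their lengths by [n]. The coset
     of the inverse of [p] is used because the distance from [p] to [k] is the length of [p^-1 * k],
     which is then the chosen point. *)
  move=> Pfin; pose rep (C : set G) := xget 1%g C.
  have [n repn] := finite_set_bounded (fun x : G => word_length x)
    (finite_image rep Pfin).
  exists n%:R => p Pp.
  have PVp := subgroupV gP Pp.
  have : lcos p^-1%g (P `&` Q) (rep (lcos p^-1%g (P `&` Q))).
    apply: (@xgetPex _ 1%g (lcos p^-1%g (P `&` Q))); exists p^-1%g, 1%g.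
      by split; apply: subgroup1.
    by rewrite mulg1.
  move=> [k [_ Qk] kE]; exists k => //.
  rewrite distE ler_nat kE; apply: repn.
  by exists (lcos p^-1%g (P `&` Q)) => //; exists p^-1%g.
move=> [r PQ].
apply: sub_finite_set (finite_image (fun u => P `&` lcos u Q) (finite_ball r)).
move=> _ [p Pp <-]; have [k Qk pk] := PQ _ (subgroupV gP Pp).
rewrite distE invgK in pk.
exists (p * k)%g => //=; rewrite -(@lcos_mem _ p); last 2 first.
- by [].
- by exists k.
apply/seteqP; split=> x.
  move=> [Px /lcosP Qx]; apply/lcosP; split=> //.
  by apply: subgroupM => //; apply: subgroupV.
by move=> [y [Py Qy] <-]; split; [apply: subgroupM | exists y].
Qed.

Lemma commensurable_coarse P Q g : group_closed [in P] -> group_closed [in Q] ->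
  commensurable P (conj_set g Q) <-> coarse_eq P (lcos g Q).
Proof.
move=> gP gQ; have gQ' := conj_set_subgroup g gQ; split.
  rewrite /commensurable (setIC P) => -[].
  rewrite [X in finite_index X P]setIC.
  move=> /(finite_index_tube gP gQ')[r PQ] /(finite_index_tube gQ' gP)[s QP].
  apply: coarse_eq_trans (coarse_eq_conj g Q); exists (Num.max r s).
  by split=> x => [/PQ|/QP]; apply: (@sub_tube R (cayley R G));
    rewrite le_max lexx ?orbT.
move=> /coarse_eq_trans-/(_ _ (coarse_eq_sym (coarse_eq_conj g Q)))[r [PQ QP]].
split; first by apply/finite_index_tube => //; exists r.
by rewrite setIC; apply/finite_index_tube => //; exists r.
Qed.

(** The commensurator is the stabiliser, under left translation, of the coarse class of [P]. This
    makes it visibly a subgroup and an invariant of that class. *)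
Lemma commensuratorE P g : group_closed [in P] ->
  commensurator P g <-> coarse_eq P (lcos g P).
Proof. by move=> gP; apply: commensurable_coarse. Qed.

Lemma commensurator_subgroup P : group_closed [in P] ->
  group_closed [in commensurator P].
Proof.
move=> gP; apply: is_subgroup.
  by apply/commensuratorE => //; rewrite lcos1; apply: coarse_eq_refl.
move=> x y /(commensuratorE _ gP) Px /(commensuratorE _ gP) Py.
apply/(commensuratorE _ gP); apply: coarse_eq_trans Px _.
rewrite -lcos_lcos; apply: coarse_eq_lcos.
have := coarse_eq_lcos y^-1%g (coarse_eq_sym Py).
by rewrite lcos_lcos mulVg lcos1.
Qed.

Lemma sub_commensurator P : group_closed [in P] -> P `<=` commensurator P.
Proof.
move=> gP x Px; apply/commensuratorE => //.
rewrite -(@lcos_mem _ 1%g P x gP); last by rewrite lcos1.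
by rewrite lcos1; apply: coarse_eq_refl.
Qed.

(** Taking for [Q] the commensurator of [P], when [P] has finite index in it, shows that the
    commensurator is its own commensurator. *)
Lemma commensurator_coarse P Q : group_closed [in P] -> group_closed [in Q] ->
  coarse_eq P Q -> commensurator P = commensurator Q.
Proof.
have H P' Q' : group_closed [in P'] -> group_closed [in Q'] ->
    coarse_eq P' Q' -> commensurator P' `<=` commensurator Q'.
  move=> gP gQ PQ x /(commensuratorE _ gP) Px; apply/(commensuratorE _ gQ).
  apply: coarse_eq_trans (coarse_eq_sym PQ) _; apply: coarse_eq_trans Px _.
  exact: coarse_eq_lcos.
by move=> gP gQ PQ; apply/seteqP; split; apply: H => //; apply: coarse_eq_sym.
Qed.

Lemma coarse_eq_commensurator P : group_closed [in P] ->
  finite_index P (commensurator P) -> coarse_eq P (commensurator P).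
Proof.
move=> gP Pfin; have gC := commensurator_subgroup gP.
have PC := sub_commensurator gP.
have [r CP] : exists r, commensurator P `<=` tube r P.
  by apply/finite_index_tube => //; rewrite (setIidr PC).
exists (Num.max 0 r); split; last first.
  move=> x /CP; apply: (@sub_tube R (cayley R G)).
  by rewrite le_max lexx orbT.
move=> x Px; exists x; first exact: PC.
by rewrite mdistxx le_max lexx.
Qed.

(** An element of all the conjugates is within [word_length (g i)] of each coset. Conversely, each
    point [x] of the tubes reaches the [i]-th coset through some [u i] in a finite ball; by the
    pigeonhole principle infinitely many [x] share the same [u], and the quotient of two such points
    lies in every conjugate. *)
Lemma infinite_conj_bigcap (J : finType) (g : J -> G) (P : J -> set G) :
  (forall i, group_closed [in P i]) ->
  infinite_set (\bigcap_i conj_set (g i) (P i)) <->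
  exists r, unbounded (\bigcap_i tube r (lcos (g i) (P i))).
Proof.
move=> gP; split.
  move=> Koo; exists (\max_i word_length (g i))%:R.
  apply/unbounded_infinite; apply: sub_infinite_set Koo => x Kx i _.
  have [p Pp pE] := Kx i Logic.I; exists (g i * p)%g; first by exists p.
  rewrite -[X in dist _ X](mulgVK (g i)) pE dist_mulr ler_nat.
  exact: leq_bigmax.
move=> [r /unbounded_infinite Uoo]; set U := \bigcap_i _ in Uoo.
have /finite_seqP[s sE] := finite_ball r.
have /choice[u uP] : forall x, exists u : J -> G, U x ->
    forall i, u i \in s /\ lcos (g i) (P i) (x * u i)%g.
  move=> x; have [Ux|nUx] := pselect (U x); last by exists (fun=> 1%g).
  suff /choice[u uP] : forall i, exists v,
    v \in s /\ lcos (g i) (P i) (x * v)%g.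
    by exists u.
  move=> i; have [c Cc xc] := Ux i Logic.I; exists (x^-1 * c)%g.
  rewrite mulVKg; split=> //.
  have : [set` s] (x^-1 * c)%g by rewrite -sE.
  by [].
(* The tuple [u x] is coded by positions in [s]. The extra position [size s] accommodates words
   outside [s], which may occur as the default value of [u] when [x] is not in [U]. *)
pose f x : {ffun J -> 'I_(size s).+1} := [ffun i => inord (index (u x i) s)].
have [t Vooo] := infinite_fiber f Uoo.
have [x0 [Ux0 fx0]] := infinite_nonempty Vooo.
(* Right multiplication by the inverse of [x0] maps the infinite fibre injectively into the
   intersection of the conjugates. *)
move=> /(finite_preimage (in2W (@mulIg G x0^-1%g))) Kfin; apply: Vooo.
apply: sub_finite_set Kfin => x [Ux fx] i _; apply/conj_setP.
have [xs Px] := uP x Ux i; have [x0s Px0] := uP x0 Ux0 i.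
have ux : u x i = u x0 i.
  have := congr1 (fun f : {ffun _ -> _} => f i) (etrans fx (esym fx0)).
  rewrite !ffunE => /(congr1 val); rewrite /= !inordK; last 2 first.
  - by rewrite ltnS index_size.
  - by rewrite ltnS index_size.
  by move=> /(congr1 (nth 1%g s)); rewrite !nth_index.
move: Px Px0 => /lcosP Px /lcosP Px0.
have := subgroup_div (gP i) Px Px0.
by rewrite ux !invgM invgK !mulgA mulgK.
Qed.

End CayleyGeometry.

(** * Quasi-isometries of pairs *)

Section CoarseMeet.
Context {R : realType}.
Implicit Types X Y : metricType R.

Definition coarse_meet X (A B : set X) : Prop :=
  exists r, unbounded (tube r A `&` tube r B).

(** Pairs of sets are treated as families over [bool], so that the results on families specialise to
    them. *)
Lemma bigcap_bool T (F : bool -> set T) : \bigcap_b F b = F true `&` F false.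
Proof.
apply/seteqP; split=> x; first by move=> Fx; split; apply: Fx.
by move=> [? ?] [].
Qed.

Lemma bool_matched X Y K (q : X -> Y) C C' D D' :
  matched K q C D -> matched K q C' D' ->
  forall b : bool, matched K q (if b then C else C') (if b then D else D').
Proof. by move=> ? ? []. Qed.

Lemma unbounded_pushI X Y K (q : X -> Y) C C' D D' r :
  quasi_isometry_const K q -> matched K q C D -> matched K q C' D' ->
  unbounded (tube r C `&` tube r C') ->
  unbounded (tube (K * r + 2 * K) D `&` tube (K * r + 2 * K) D').
Proof.
move=> qK CD CD' uC; have :=
  @unbounded_push _ _ _ _ _ _ _ _ r qK (bool_matched CD CD').
by rewrite !bigcap_bool; apply.
Qed.

Lemma coarse_meet_pull X Y K (q : X -> Y) C C' D D' :
  quasi_isometry_const K q -> matched K q C D -> matched K q C' D' ->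
  coarse_meet D D' -> coarse_meet C C'.
Proof.
move=> qK CD CD' [r uD].
have := @unbounded_pull _ _ _ _ _ _ _ _ r qK (bool_matched CD CD').
by rewrite bigcap_bool => /(_ uD)[s]; rewrite bigcap_bool; exists s.
Qed.

Lemma coarse_meet_coarse X (C C' D D' : set X) :
  coarse_eq C C' -> coarse_eq D D' -> coarse_meet C D -> coarse_meet C' D'.
Proof.
move=> [r [CC' _]] [s [DD' _]] [t uCD]; exists (t + Num.max r s).
apply: unbounded_sub uCD => x [xC xD]; split.
  by apply: sub_tube (tube_tube CC' xC); rewrite lerD2l le_max lexx.
by apply: sub_tube (tube_tube DD' xD); rewrite lerD2l le_max lexx orbT.
Qed.

Lemma coarse_eq_meet X (C D : set X) :
  unbounded C -> coarse_eq C D -> coarse_meet C D.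
Proof.
move=> uC [r [CD _]]; exists (Num.max 0 r); apply: unbounded_sub uC => x Cx.
split; first by exists x; rewrite // mdistxx le_max lexx.
by apply: sub_tube (CD _ Cx); rewrite le_max lexx orbT.
Qed.

End CoarseMeet.

Section CayleyMeet.
Context {R : realType} {G : fgGroup}.
Local Notation coarse_meet := (@coarse_meet R (cayley R G)).
Implicit Types (g h : G) (P Q : set G).

Lemma infinite_conjI g h P Q : group_closed [in P] -> group_closed [in Q] ->
  infinite_set (conj_set g P `&` conj_set h Q) <->
  coarse_meet (lcos g P) (lcos h Q).
Proof.
move=> gP gQ.
have gPQ b : group_closed [in (if b then P else Q)] by case: b.
have := @infinite_conj_bigcap R G bool (fun b => if b then g else h) _ gPQ.
rewrite (bigcap_bool (fun b =>
  conj_set (if b then g else h) (if b then P else Q))).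
move=> /= ->.
by split=> -[r uPQ]; exists r; move: uPQ; rewrite bigcap_bool.
Qed.

Lemma coarse_meet_lcos x C D :
  coarse_meet C D -> coarse_meet (lcos x C) (lcos x D).
Proof.
move=> [r uCD]; exists r => -[B HB]; apply: uCD;
  exists B => y z [yC yD] [zC zD].
have tr E (w : G) : @tube R (cayley R G) r E w ->
    @tube R (cayley R G) r (lcos x E) (x * w)%g.
  by move=> [e Ee we]; exists (x * e)%g; [exists e | rewrite dist_mull].
by rewrite -(dist_mull x); apply: HB; split; apply: tr.
Qed.

End CayleyMeet.

Section Pairs.
Context {R : realType}.
Implicit Types A B : group_pair.
Local Notation coarse_eq A := (@coarse_eq R (cayley R A)).
Local Notation coarse_meet A := (@coarse_meet R (cayley R A)).
Local Notation dist A := (@mdist R (cayley R A)).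

Lemma gp_subgroup A P : gp_per A P -> group_closed [in P].
Proof. exact: per_subgroup. Qed.

Lemma gp_infinite A P : gp_per A P -> infinite_set P.
Proof. exact: per_infinite. Qed.

Lemma gp_finite A : finite_set (gp_per A).
Proof. exact: per_finite. Qed.

Lemma cosets_lcos A (g : A) P : gp_per A P -> cosets A (lcos g P).
Proof. by exists g, P. Qed.

Lemma lcos_cosets A (g : A) C : cosets A C -> cosets A (lcos g C).
Proof. by move=> [h [P [PP ->]]]; exists (g * h)%g, P; rewrite lcos_lcos. Qed.

Lemma coset_nonempty A C : cosets A C -> C !=set0.
Proof.
move=> [g [P [/gp_subgroup/subgroup1 P1 ->]]]; exists g, 1%g => //.
by rewrite mulg1.
Qed.

Lemma coset_unbounded A C :
  cosets A C -> @unbounded R (cayley R A) C.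
Proof.
move=> [g [P [/gp_infinite Poo ->]]]; apply/unbounded_infinite => Cfin.
apply: Poo; have := finite_preimage (in2W (@mulgI A g)) Cfin.
by apply: sub_finite_set => x Px; exists x.
Qed.

(** A coset through [x] has the form [lcos x P]; there are finitely many [x] in the ball and
    finitely many [P]. *)
Lemma finite_cosets_near A (r : R) :
  finite_set [set C | cosets A C /\ exists2 x, C x & dist A 1%g x <= r].
Proof.
apply: sub_finite_set
  (finite_image2 (fun u P => lcos u P) (finite_ball r) (gp_finite A)).
move=> _ [[g [P [PP ->]]] [x Cx xr]]; exists x.
  by rewrite distE invg1 mul1g in xr.
by exists P => //; rewrite (lcos_mem (gp_subgroup PP) Cx).
Qed.

Lemma finite_cosets_nearx A (r : R) (y : A) :
  finite_set [set C | cosets A C /\ exists2 x, C x & dist A y x <= r].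
Proof.
apply: sub_finite_set (finite_image (lcos y) (finite_cosets_near A r)).
move=> C [CC [x Cx yx]]; exists (lcos y^-1%g C); last first.
  by rewrite lcos_lcos mulgV lcos1.
split; first exact: lcos_cosets.
by exists (y^-1 * x)%g; [exists x | rewrite -(dist_mull y) mulg1 mulVKg].
Qed.

Definition pair_quasi_isometry (K : R) A B (q : cayley R A -> cayley R B) :
    Prop :=
  [/\ quasi_isometry_const K q,
      forall C : set (cayley R A), cosets A C ->
        exists2 D : set (cayley R B), cosets B D & matched K q C D
    & forall D : set (cayley R B), cosets B D ->
        exists2 C : set (cayley R A), cosets A C & matched K q C D].

Lemma quasi_isometric_const A B : quasi_isometric R A B ->
  exists (K : R) (q : cayley R A -> cayley R B), pair_quasi_isometry K q.
Proof.
move=> [q [M [/quasi_isometryP[K0 qK] M0 qC qD]]].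
exists (Num.max K0 M), q; split.
- by apply: qK; rewrite le_max lexx.
- move=> C /qC[D DD CD]; exists D => //;
  apply: matched_le (hausdorff_matched CD).
  by rewrite le_max lexx orbT.
- move=> D /qD[C CC CD]; exists C => //;
  apply: matched_le (hausdorff_matched CD).
  by rewrite le_max lexx orbT.
Qed.

(** A property invariant under quasi-isometry of pairs is geometric, with the pair itself as the
    virtually isomorphic one. *)
Lemma geometric_propertyI (Pr : group_pair -> Prop) :
  (forall A B K (q : cayley R A -> cayley R B), pair_quasi_isometry K q ->
     Pr A -> Pr B) -> geometric_property R Pr.
Proof.
move=> H A B /quasi_isometric_const[K [q qK]] PA; exists B.
  exact: Relation_Operators.rst_refl.
exact: H qK PA.
Qed.

(** * Properties that are invariant under quasi-isometry of pairs *)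

Section Transfer.
Variables (A B : group_pair) (K : R) (q : cayley R A -> cayley R B).
Hypothesis qK : pair_quasi_isometry K q.

Lemma match_family J (D : J -> set B) : (forall i, cosets B (D i)) ->
  exists (g : J -> A) (P : J -> set A), (forall i, gp_per A (P i)) /\
    forall i, matched K q (lcos (g i) (P i)) (D i).
Proof.
move=> DD; have [_ _ qD] := qK.
have /choice[gP gPP] : forall i, exists gP : A * set A,
    gp_per A gP.2 /\ matched K q (lcos gP.1 gP.2) (D i).
  by move=> i; have [_ [g [P [PP ->]]] CD] := qD _ (DD i); exists (g, P).
by exists (fun i => (gP i).1), (fun i => (gP i).2); split=> i; case: (gPP i).
Qed.

Lemma infinite_conj_pull (J : finType) (h : J -> B) (Q : J -> set B)
    (g : J -> A) (P : J -> set A) :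
  (forall i, gp_per B (Q i)) -> (forall i, gp_per A (P i)) ->
  (forall i, matched K q (lcos (g i) (P i)) (lcos (h i) (Q i))) ->
  infinite_set (\bigcap_i conj_set (h i) (Q i)) ->
  infinite_set (\bigcap_i conj_set (g i) (P i)).
Proof.
move=> QQ PP CD; have [q' _ _] := qK.
move=> /(@infinite_conj_bigcap R _ _ _ _ (fun i => gp_subgroup (QQ i)))[r].
move=> /(unbounded_pull q' CD)[s uC].
by apply/(@infinite_conj_bigcap R _ _ _ _ (fun i => gp_subgroup (PP i)));
  exists s.
Qed.

(** The cosets matched with one given [C] all meet the ball of radius [K] about the image of a fixed
    point of [C]; after translation they are among the finitely many cosets meeting the ball about
    the identity, whose number is [N]. The map [e] picks one index for each value of [C]. *)
Lemma match_multiplicity : exists N : nat,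
  forall m (D : 'I_m -> set B) (C : 'I_m -> set A),
    injective D -> (forall i, cosets B (D i)) -> (forall i, cosets A (C i)) ->
    (forall i, matched K q (C i) (D i)) ->
    exists (k : nat) (e : 'I_k -> 'I_m),
      injective (fun j => C (e j)) /\ (m <= k * N)%N.
Proof.
have /finite_seqP[t tE] := finite_cosets_near B K.
exists (size t) => m D C Dinj DD CC CD.
pose v := undup (codom C).
have vP (j : 'I_(size v)) : exists i, C i == nth set0 v j.
  have : nth set0 v j \in v by apply: mem_nth.
  by rewrite mem_undup => /codomP[i ->]; exists i.
have /choice[e eP] := vP; exists (size v), e; split.
  move=> i j Cij; apply/val_inj/eqP.
  rewrite -(nth_uniq set0 (ltn_ord i) (ltn_ord j)) ?undup_uniq //.
  by rewrite -(eqP (eP i)) -(eqP (eP j)) Cij.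
(* Every coset matched with [E] meets the ball about [y E]. *)
pose y (E : set A) : B := q (xget (1%g : A) E).
(* The map [f] is injective, since [C i] determines the translation, and takes values in the product
   of [v] and [t]; counting gives the bound. *)
pose f i := (C i, lcos (y (C i))^-1%g (D i)).
rewrite -(size_allpairs pair) -[X in (X <= _)%N](size_enum_ord m) -(size_map f).
apply: uniq_leq_size.
  rewrite map_inj_uniq ?enum_uniq // => i j [Cij].
  rewrite Cij => /(congr1 (lcos (y (C j)))); rewrite !lcos_lcos mulgV !lcos1.
  exact: Dinj.
move=> _ /mapP[i _ ->]; rewrite /f; apply: allpairs_f.
  by rewrite mem_undup codom_f.
suff : [set` t] (lcos (y (C i))^-1%g (D i)) by [].
rewrite -tE; split; first exact: lcos_cosets.
have Cy : C i (xget (1%g : A) (C i)).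
  by have [x Cx] := coset_nonempty (CC i); apply: xgetI Cx.
have [/(_ _ Cy)[d Dd yd] _] := CD i.
exists ((y (C i))^-1 * d)%g; first by exists d.
by rewrite -(dist_mull (y (C i))) mulg1 mulVKg.
Qed.

(** Pull the family back and keep one index for each distinct coset of [A]. Dropping indices only
    enlarges the intersection, and the multiplicity bounds what was dropped. *)
Lemma finite_height_transfer : finite_height A -> finite_height B.
Proof.
move=> [N hA]; have [M hM] := match_multiplicity.
exists (N * M)%N => m h Q QQ Dinj Doo.
have DD i : cosets B (lcos (h i) (Q i)) by apply: cosets_lcos.
have [g [P [PP CD]]] := match_family DD.
have CC i : cosets A (lcos (g i) (P i)) by apply: cosets_lcos.
have [k [e [einj mk]]] := hM _ _ _ Dinj DD CC CD.
apply: leq_trans mk _; apply: leq_mul => //.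
apply: (hA k (g \o e) (P \o e)) => // [i|]; first exact: PP.
apply: sub_infinite_set (infinite_conj_pull QQ PP CD Doo).
by move=> x Cx j _; apply: Cx.
Qed.

Lemma conjI_pull (h h' : B) (Q Q' : set B) (g g' : A) (P P' : set A) :
  gp_per B Q -> gp_per B Q' -> gp_per A P -> gp_per A P' ->
  matched K q (lcos g P) (lcos h Q) -> matched K q (lcos g' P') (lcos h' Q') ->
  infinite_set (conj_set h Q `&` conj_set h' Q') ->
  infinite_set (conj_set g P `&` conj_set g' P').
Proof.
move=> QQ QQ' PP PP' CD CD'; have [q' _ _] := qK.
move=> /(@infinite_conjI R) - /(_ (gp_subgroup QQ) (gp_subgroup QQ')) H.
apply/(@infinite_conjI R); rewrite ?gp_subgroup //; first exact: gp_subgroup PP.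
  exact: gp_subgroup PP'.
exact: coarse_meet_pull q' CD CD' H.
Qed.

Lemma finite_width_transfer : finite_width A -> finite_width B.
Proof.
move=> [N hA]; have [M hM] := match_multiplicity.
exists (N * M)%N => m h Q QQ Dinj Doo.
have DD i : cosets B (lcos (h i) (Q i)) by apply: cosets_lcos.
have [g [P [PP CD]]] := match_family DD.
have CC i : cosets A (lcos (g i) (P i)) by apply: cosets_lcos.
have [k [e [einj mk]]] := hM _ _ _ Dinj DD CC CD.
apply: leq_trans mk _; apply: leq_mul => //.
apply: (hA k (g \o e) (P \o e)) => // [i|i j ij /=]; first exact: PP.
(* The selection [e] need not be increasing, so both orders of [e i] and [e j] occur; the
   intersection is symmetric. *)
have eij : e i != e j.
  by apply: contraTneq ij => eij; rewrite (einj i j) ?ltnn // eij.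
move: eij; rewrite neq_ltn => /orP[eij|eij]; last rewrite setIC.
  exact: conjI_pull (CD _) (CD _) (Doo _ _ eij).
exact: conjI_pull (CD _) (CD _) (Doo _ _ eij).
Qed.

Lemma fenced_transfer :
  fenced_infinite_intersections R A -> fenced_infinite_intersections R B.
Proof.
have [q' qC qD] := qK; have [K1 qu ql _] := q'.
(* The extra 1 pays for the infimum not being known to be attained; the rest is the distortion of a
   distance between matched points. *)
move=> [tau tau0 hA]; exists (K * (tau + 1) + 3 * K); first nra.
move=> h h' Q Q' QQ QQ' Doo.
have [_ [g [P [PP ->]]] CD] := qD _ (cosets_lcos h QQ).
have [_ [g' [P' [PP' ->]]] CD'] := qD _ (cosets_lcos h' QQ').
have tau1 : tau < tau + 1 by lra.
have := hA _ _ _ _ PP PP' (conjI_pull QQ QQ' PP PP' CD CD' Doo).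
move=> /(set_dist_le_lt tau1)[c [c' [Cc Cc' cc']]].
have [/(_ c Cc)[d Dd cd] _] := CD; have [/(_ c' Cc')[d' Dd' cd'] _] := CD'.
apply: set_dist_le Dd Dd' _; apply: le_trans (matched_dist_image q' cd cd') _.
by rewrite lerD2r ler_pM2l ?(ltW cc') //; lra.
Qed.

Lemma tau_network_transfer :
  (exists2 tau : R, 0 <= tau &
     tau_network tau (cosets A : set (set (cayley R A)))) ->
  exists2 tau : R, 0 <= tau &
    tau_network tau (cosets B : set (set (cayley R B))).
Proof.
have [q' qC qD] := qK; have [K1 qu ql qs] := q'.
move=> [tau tau0 [Acov Achain]]; exists (K * (tau + 1) + 3 * K); first nra.
have tau1 : tau < tau + 1 by lra.
split.
  apply/seteqP; split=> // y _; have [x xy] := qs y.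
  have [C CC /(nbhd_tube tau1)[c Cc xc]] : (\bigcup_(C in cosets A)
    @nbhd R (cayley R A) tau C) x by rewrite -Acov.
  have [D DD [/(_ c Cc)[d Dd cd] _]] := qC C CC; exists D => //.
  apply: tube_nbhd; exists d => //.
  apply: le_trans (matched_dist_image q' xy cd) _.
  by rewrite lerD2r ler_pM2l //; lra.
move=> E F EE FF; have [CE CCE CDE] := qD E EE; have [CF CCF CDF] := qD F FF.
have [n [c [c0 cn cC cU]]] := Achain _ _ CCE CCF.
(* A match for every coset of [A]; the empty set is a default value off the cosets. *)
have /choice[s sP] : forall C, exists D : set B,
    cosets A C -> cosets B D /\ matched K q C D.
  move=> C; have [CC|nC] := pselect (cosets A C); last by exists set0.
  by have [D DD CD] := qC C CC; exists D.
(* The chain is [E], the matches of [c 0] to [c n], then [F]. The ends are added because the chosen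
   matches of [c 0] and [c n] may differ from [E] and [F]. *)
pose e i := if i is i'.+1 then if (i' <= n)%N then s (c i') else F else E.
exists n.+2, e; split=> //; first by rewrite /e ltnn.
  move=> [//|i] _; rewrite /e; case: ifPn => // ni.
  by have [] := sP _ (cC i ni).
(* Both ends of the chain are links between two cosets matched with the same [C], and [C] itself is
   unbounded. *)
have meet C D D' : matched K q C D -> matched K q C D' ->
    cosets A C -> cosets B D -> cosets B D' ->
    unbounded (nbhd (K * (tau + 1) + 3 * K) D `&`
               nbhd (K * (tau + 1) + 3 * K) D').
  move=> CD CD' CC _ _.
  have uC : @unbounded R (cayley R A) (tube 0 C `&` tube 0 C).
    apply: unbounded_sub (coset_unbounded CC) => x Cx.
    by split; exists x; rewrite // mdistxx.
  apply: unbounded_sub (unbounded_pushI q' CD CD' uC) => x [Dx D'x].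
  by split; apply: tube_nbhd; [apply: sub_tube Dx | apply: sub_tube D'x]; nra.
move=> [|i] ni /=.
  have [] := sP _ (cC 0%N isT); rewrite /e /= c0 => sc cs.
  exact: meet CDE cs CCE EE sc.
have {}ni : (i <= n)%N by []; rewrite /e ni; have [sc cs] := sP _ (cC i ni).
case: ifPn => [ni'|]; last first.
  rewrite -leqNgt => ni'; have ein : i = n by apply/eqP; rewrite eqn_leq ni.
  move: sc cs; rewrite ein cn => sc cs.
  exact: meet cs CDF CCF sc FF.
have [sc' cs'] := sP _ (cC _ ni').
have uC : @unbounded R (cayley R A) (tube (tau + 1) (c i) `&`
                                     tube (tau + 1) (c i.+1)).
  by apply: unbounded_sub (cU i ni') =>
    x [/(nbhd_tube tau1) ? /(nbhd_tube tau1) ?].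
apply: unbounded_sub (unbounded_pushI q' cs cs' uC) => x [Dx D'x].
by split; apply: tube_nbhd; [apply: sub_tube Dx | apply: sub_tube D'x]; nra.
Qed.

Lemma network_transfer : network R A -> network R B.
Proof.
have [_ qC _] := qK.
move=> [[P PP] /tau_network_transfer Bnet]; split=> //.
by have [D [h [Q [QQ _]]] _] := qC _ (cosets_lcos 1%g PP); exists Q.
Qed.

Lemma bounded_packing_transfer : bounded_packing R A -> bounded_packing R B.
Proof.
have [q' qC qD] := qK; have [K1 qu ql _] := q'.
move=> bA r; have [M hM] := match_multiplicity.
(* Cosets of [B] closer than [r] have matches at distance at most [K * (r + 2 * K) + K]; the
   additional 1 makes the contradiction strict. *)
have [N hA] := bA (K * (r + 2 * K) + K + 1).
(* With more than [N * M] cosets, at least [N] distinct matches remain, and the packing of [A] is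
   applied to [N] of them. *)
exists (N * M).+1 => D DD Dinj.
have [g [P [PP CD]]] := match_family DD.
have CC i : cosets A (lcos (g i) (P i)) by apply: cosets_lcos.
have [k [e [einj mk]]] := hM _ _ _ Dinj DD CC CD.
have Nk : (N <= k)%N.
  by rewrite leqNgt; apply: contraTN mk => kN;
    rewrite -ltnNge ltnS leq_mul // ltnW.
have winj : injective (widen_ord Nk) by move=> i j /(congr1 val) ij;
  apply: val_inj.
have [i [j [ij dij]]] := hA (fun i => lcos (g (e (widen_ord Nk i)))
    (P (e (widen_ord Nk i)))) (fun i => CC _) (inj_comp einj winj).
exists (e (widen_ord Nk i)), (e (widen_ord Nk j)); split.
  by move=> eij; apply/ij/winj/einj; rewrite eij.
rewrite leNgt; apply/negP => /set_dist_lt[d [d' [Dd Dd' dd']]].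
have [_ /(_ d Dd)[c Cc cd]] := CD (e (widen_ord Nk i)).
have [_ /(_ d' Dd')[c' Cc' cd']] := CD (e (widen_ord Nk j)).
have cc' : mdist c c' <= K * (r + 2 * K) + K.
  apply: le_trans (matched_dist q' cd cd') _.
  by rewrite lerD2r ler_pM2l ?lerD2r ?(ltW dd') //; lra.
have := le_trans dij (set_dist_le Cc Cc' cc').
by rewrite lee_fin; lra.
Qed.

Lemma finite_packing_transfer : finite_packing A -> finite_packing B.
Proof.
have [q' qC qD] := qK; have [K1 qu ql _] := q'.
move=> [F [FC Ffin hA]].
have [n nF] := finite_set_bounded
  (fun C => word_length (xget (1%g : A) C)) Ffin.
(* The integer [n] bounds the length of a chosen point in each member of [F]. The map [q] stretches
   this to [K * n%:R + K], and matching adds another [K]. *)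
exists [set D | cosets B D /\
  exists2 x, D x & dist B 1%g x <= K * n%:R + 2 * K].
split=> [D []//||m h Q QQ Doo]; first exact: finite_cosets_near.
have DD i : cosets B (lcos (h i) (Q i)) by apply: cosets_lcos.
have [g [P [PP CD]]] := match_family DD.
have [x xF] := hA _ g P PP (infinite_conj_pull QQ PP CD Doo).
(* Each coset of the family passes within [n] of the inverse of [x], so its match passes near the
   image of that point, which is translated to the identity. *)
exists (q x^-1%g : B)^-1%g => i; split.
  by apply: lcos_cosets.
pose z := xget (1%g : A) (lcos x (lcos (g i) (P i))).
have zC : lcos x (lcos (g i) (P i)) z.
  by have [w Cw] := coset_nonempty (FC _ (xF i)); apply: xgetI Cw.
have [c Cc cz] := zC; have [/(_ c Cc)[d Dd cd] _] := CD i.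
exists ((q x^-1%g : B)^-1 * d)%g; first by exists d.
rewrite -(dist_mull (q x^-1%g : B)) mulg1 mulVKg.
have xc : dist A x^-1%g c <= n%:R.
  by rewrite distE invgK cz ler_nat; apply: nF.
apply: le_trans (metric_triangle _ (q c) _) _.
have := qu x^-1%g c; have : K * mdist (x^-1%g : cayley R A) c <= K * n%:R.
  by rewrite ler_pM2l //; lra.
lra.
Qed.

(** The members of the class of [D] are matched with members of the class of [C], finite in number,
    and each of these has finitely many matches by local finiteness of cosets. *)
Lemma finite_coarse_class_transfer :
  (forall C, cosets A C ->
    finite_set [set C' | cosets A C' /\ coarse_eq A C C']) ->
  forall D, cosets B D -> finite_set [set D' | cosets B D' /\ coarse_eq B D D'].
Proof.
move=> hA D DD; have [q' qC qD] := qK.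
have [C CC CD] := qD D DD.
apply: sub_finite_set (bigcup_finite (hA C CC) _ (F := fun C' =>
  [set D' | cosets B D' /\ matched K q C' D'])).
  move=> D' [DD' cDD']; have [C' CC' CD'] := qD D' DD'.
  by exists C' => //; split => //; apply: coarse_matched q' CD CD' cDD'.
move=> C' [CC' _]; have [c Cc] := coset_nonempty CC'.
apply: sub_finite_set (finite_cosets_nearx K (q c)) => D' [DD' [CD' _]].
by split=> //; apply: CD'.
Qed.

End Transfer.

(** * Commensurators and almost malnormal collections *)

Lemma finite_index_commensuratorP A : finite_index_in_commensurator A <->
  forall C, cosets A C -> finite_set [set C' | cosets A C' /\ coarse_eq A C C'].
Proof.
split=> [fA _ [g [P [PP ->]]]|fA P PP]; last first.
  have := fA P; rewrite -{1}(lcos1 P) => /(_ (cosets_lcos 1%g PP)).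
  apply: sub_finite_set => _ [g /(commensuratorE _ (gp_subgroup PP)) Pg <-].
  by split=> //; apply: cosets_lcos.
pose S Q := [set lcos h Q | h in [set h | coarse_eq A (lcos g P) (lcos h Q)]].
apply: (@sub_finite_set _ _ (\bigcup_(Q in gp_per A) S Q)).
  by move=> _ [[h [Q [QQ ->]]] gPhQ]; exists Q => //; exists h.
apply: bigcup_finite => [|Q QQ]; first exact: gp_finite.
have [[h0 h0P]|S0] := pselect (exists h, coarse_eq A (lcos g P) (lcos h Q));
  last first.
  by apply: (@sub_finite_set _ _ set0) => // C [h hP _]; case: S0; exists h.
(* For fixed [Q], the cosets in the class are the translates by [h0] of the cosets of [Q] in its
   commensurator. *)
apply: sub_finite_set (finite_image (lcos h0) (fA Q QQ)) => _ [h hP <-].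
exists (lcos (h0^-1 * h)%g Q); last by rewrite lcos_lcos mulVKg.
exists (h0^-1 * h)%g => //; apply/(@commensuratorE R _ _ _ (gp_subgroup QQ)).
have := coarse_eq_lcos h0^-1%g (coarse_eq_trans (coarse_eq_sym h0P) hP).
by rewrite !lcos_lcos mulVg lcos1.
Qed.

Lemma self_commensurating_finite_index A :
  self_commensurating A -> finite_index_in_commensurator A.
Proof.
move=> sA P PP; have gP := gp_subgroup PP; rewrite /finite_index -(sA P PP).
apply: (@sub_finite_set _ _ [set P]) => // _ [x Px <-].
by rewrite -(@lcos_mem _ 1%g _ _ gP) lcos1.
Qed.

Lemma finite_index_in_commensurator_transfer A B K
    (q : cayley R A -> cayley R B) : pair_quasi_isometry K q ->
  finite_index_in_commensurator A -> finite_index_in_commensurator B.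
Proof.
move=> qK /finite_index_commensuratorP hA.
by apply/finite_index_commensuratorP/(finite_coarse_class_transfer qK).
Qed.

(** A single commensurability step suffices, since finite index makes each [rep P] coarsely equal to
    its commensurator. The map [rep] allows the same lemma to keep all subgroups or only one from
    each class. *)
Lemma commensurator_pair A (rep : set A -> set A) :
  (forall P, gp_per A P -> gp_per A (rep P)) ->
  (forall P, gp_per A P -> exists g, coarse_eq A P (lcos g (rep P))) ->
  finite_index_in_commensurator A ->
  exists Q : peripheral A,
    per_set Q = [set commensurator (rep P) | P in gp_per A]
    /\ virtually_isomorphic A (GroupPair Q).
Proof.
case: A rep => G p rep repP repE fA.
pose S := [set commensurator (rep P) | P in gp_per (GroupPair p)].
have Sfin : finite_set S by apply/finite_image/gp_finite.
have Sgroup C : S C -> group_closed [in C].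
  by move=> [P PP <-]; apply/(@commensurator_subgroup R)/gp_subgroup/repP.
have Soo C : S C -> infinite_set C.
  move=> [P PP <-]; apply: sub_infinite_set (gp_infinite (repP _ PP)).
  exact/(@sub_commensurator R)/gp_subgroup/repP.
exists (Peripheral Sfin Sgroup Soo); split=> //.
have gR P : gp_per (GroupPair p) P -> group_closed [in rep P].
  by move=> PP; apply/gp_subgroup/repP.
have CP P : gp_per (GroupPair p) P ->
    coarse_eq (GroupPair p) (rep P) (commensurator (rep P)).
  move=> PP; apply: coarse_eq_commensurator; last exact/fA/repP.
  exact: gR.
apply: Relation_Operators.rst_step; apply: vi_commensurable.
  move=> _ [P PP <-]; exists (rep P), 1%g; split; first exact: repP.
  apply/(@commensurable_coarse R) => /=.
  - by apply: Sgroup; exists P.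
  - exact: gR.
  - by rewrite lcos1; apply/coarse_eq_sym/CP.
move=> P PP; have [g Pg] := repE P PP.
exists (commensurator (rep P)), g; split; first by exists P.
apply/(@commensurable_coarse R) => /=.
- exact: (@gp_subgroup (GroupPair p)).
- by apply: Sgroup; exists P.
- by apply: coarse_eq_trans Pg _; apply/coarse_eq_lcos/CP.
Qed.

Lemma self_commensurating_geometric : geometric_property R self_commensurating.
Proof.
move=> A B /quasi_isometric_const[K [q qK]] /self_commensurating_finite_index.
move=> /(finite_index_in_commensurator_transfer qK) fB.
have [||Q [QE BQ]] := @commensurator_pair B id _ _ fB => //.
  by move=> P _; exists 1%g; rewrite lcos1; apply: coarse_eq_refl.
exists (GroupPair Q) => // C; rewrite /gp_per /= QE => -[P PP <-].
have gP := gp_subgroup PP.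
apply: (@commensurator_coarse R) => //;
  first exact: (@commensurator_subgroup R).
by apply: coarse_eq_commensurator => //; apply: fB.
Qed.

(** If [g] commensurates [P], then [lcos g P] and [P] are coarsely equal and unbounded, so [P] and
    its conjugate by [g] intersect in an infinite set, and malnormality puts [g] in [P]. *)
Lemma almost_malnormal_self_commensurating A :
  almost_malnormal A -> self_commensurating A.
Proof.
move=> mA P PP; have gP := gp_subgroup PP; apply/seteqP; split.
  exact: (@sub_commensurator R).
move=> g /(@commensuratorE R _ _ _ gP)/coarse_eq_sym gPP.
have [fin|[]//] := mA P P g PP PP.
have : infinite_set (conj_set g P `&` conj_set 1%g P).
  apply/(@infinite_conjI R) => //; rewrite lcos1; apply: coarse_eq_meet gPP.
  exact/coset_unbounded/cosets_lcos.
by rewrite conj_set1.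
Qed.

(** Almost malnormality in coarse terms: distinct cosets have no unbounded coarse intersection. In
    this form it can be used across a quasi-isometry. *)
Lemma almost_malnormal_coset_eq A (g h : A) P Q :
  almost_malnormal A -> gp_per A P -> gp_per A Q ->
  coarse_meet A (lcos g P) (lcos h Q) -> lcos g P = lcos h Q.
Proof.
move=> mA PP QQ /(coarse_meet_lcos h^-1%g); rewrite !lcos_lcos mulVg => gPQ.
have gP := gp_subgroup PP; have gQ := gp_subgroup QQ.
have := mA P Q (h^-1 * g)%g PP QQ; rewrite -{1}(conj_set1 Q).
move/(@infinite_conjI R _ _ _ _ _ gP gQ) in gPQ.
case=> // -[<- Pgh]; apply/esym/lcos_mem => //; exact/lcosP.
Qed.

(** The new collection consists of the commensurators of one representative per class of [E].
    Without this choice, commensurators of subgroups commensurable up to conjugation could appear as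
    different members with infinite intersections of conjugates. *)
Lemma almost_malnormal_geometric : geometric_property R almost_malnormal.
Proof.
move=> A B /quasi_isometric_const[K [q qK]] mA.
have fB := finite_index_in_commensurator_transfer qK
  (self_commensurating_finite_index (almost_malnormal_self_commensurating mA)).
pose E (P Q : set B) := exists g, coarse_eq B P (lcos g Q).
have Erefl P : E P P by exists 1%g; rewrite lcos1; apply: coarse_eq_refl.
have Esym P Q : E P Q -> E Q P.
  move=> [g PgQ]; exists g^-1%g.
  have := coarse_eq_lcos g^-1%g (coarse_eq_sym PgQ).
  by rewrite lcos_lcos mulVg lcos1.
have Etrans P Q S : E P Q -> E Q S -> E P S.
  move=> [g PgQ] [h QhS]; exists (g * h)%g; rewrite -lcos_lcos.
  exact/(coarse_eq_trans PgQ)/coarse_eq_lcos.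
(* [xget] returns the same value on equal sets, so the representative depends only on the class of
   [P]. *)
pose rep P := xget set0 [set Q | gp_per B Q /\ E P Q].
have repP P : gp_per B P -> gp_per B (rep P) /\ E P (rep P).
  by move=> PP; apply: (@xgetPex _ set0 [set Q | gp_per B Q /\ E P Q]);
    exists P.
have repE P Q : E P Q -> rep P = rep Q.
  move=> PQ; congr xget; apply/seteqP; split=> S [SS].
    by move=> /(Etrans _ _ _ (Esym _ _ PQ)).
  by move=> /(Etrans _ _ _ PQ).
have [||Q [QE BQ]] := @commensurator_pair B rep _ _ fB.
- by move=> P /repP[].
- by move=> P /repP[].
exists (GroupPair Q) => // C C' g; rewrite /gp_per /= QE.
move=> [P /repP[rP PrP] <-] [P' /repP[rP' PrP'] <-].
have gP := gp_subgroup rP; have gP' := gp_subgroup rP'.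
have cP := @coarse_eq_commensurator R _ _ gP (fB _ rP).
have cP' := @coarse_eq_commensurator R _ _ gP' (fB _ rP').
have [fin|oo] := pselect (finite_set
  (conj_set g (commensurator (rep P)) `&` commensurator (rep P')));
    [by left|right].
have meet : coarse_meet B (lcos g (rep P)) (lcos 1%g (rep P')).
  have gcP := coarse_eq_lcos g (coarse_eq_sym cP).
  have gcP' := coarse_eq_lcos 1%g (coarse_eq_sym cP').
  apply: coarse_meet_coarse gcP gcP' _.
  apply/(@infinite_conjI R); rewrite ?conj_set1 //;
    exact: (@commensurator_subgroup R).
have [q' _ qD] := qK.
have [_ [a [S [SS ->]]] CD] := qD _ (@cosets_lcos B g _ rP).
have [_ [a' [S' [SS' ->]]] CD'] := qD _ (@cosets_lcos B 1%g _ rP').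
(* In [A] the two matching cosets meet coarsely, hence coincide. Both cosets of [B] are then matched
   with the same one, so they are coarsely equal. *)
have aS := almost_malnormal_coset_eq mA SS SS'
  (coarse_meet_pull q' CD CD' meet).
rewrite aS in CD; have := matched_coarse CD CD'; rewrite lcos1 => gPP'.
have rr : rep P = rep P'.
  have PP' : E (rep P') (rep P) by exists g; apply: coarse_eq_sym.
  by rewrite (repE _ _ PrP) (repE _ _ PrP') (repE _ _ PP').
rewrite -rr in gPP' *; split=> //; apply/(@commensuratorE R) => //.
exact: coarse_eq_sym.
Qed.

End Pairs.

(** * Thickness *)

Section UltraseqTheory.
Context {R : realType}.
Variable w : nonprincipal_ultrafilter.

(** Initial segments are removed one singleton at a time. Limits at infinity, such as that of the
    scaling constants, thereby hold along the ultrafilter. *)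
Lemma nonprincipal_cofinite : \oo `<=` ultra_sets w.
Proof.
have wN N : ultra_sets w [set i | (N <= i)%N].
  elim: N => [|N IH]; first by apply: filterS filterT.
  have [/(ultra_nonprincipal (n := N))//|wN] :=
    in_ultra_setVsetC [set N] (ultra_setsP w).
  apply: filterS (filterI IH wN) => i /= [Ni iN].
  by rewrite ltn_neqAle Ni andbT; apply/eqP => /esym.
by move=> A [N _ NA]; apply: filterS (wN N) => i Ni; apply: NA.
Qed.

Section OneSpace.
Variables (Y : nat -> metricType R) (b : forall i, Y i) (d : nat -> {posnum R}).
Implicit Types x y z : ultraseq w b d.

Lemma ultraseq_dist_ge0 x y : 0 <= ultraseq_dist x y.
Proof.
apply: (cvgr_to_ge (@ultraseq_dist_cvg _ _ _ _ _ x y)).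
by apply: nearW => i; rewrite divr_ge0 // mdist_ge0.
Qed.

Lemma ultraseq_dist_sym x y : ultraseq_dist x y = ultraseq_dist y x.
Proof. by rewrite /ultraseq_dist; under eq_fun do rewrite metric_sym. Qed.

Lemma ultraseq_dist_triangle y x z :
  ultraseq_dist x z <= ultraseq_dist x y + ultraseq_dist y z.
Proof.
apply: (ler_cvg_to (@ultraseq_dist_cvg _ _ _ _ _ x z)
  (cvgD (@ultraseq_dist_cvg _ _ _ _ _ x y) (@ultraseq_dist_cvg _ _ _ _ _ y z))).
by apply: nearW => i /=; rewrite -mulrDl ler_pM2r // metric_triangle.
Qed.

Definition ultralimit_pi x : ultralimit w b d :=
  \pi_({eq_quot ultraseq_equiv w b d})%qT x.

Lemma ultraseq_dist_repr x : ultraseq_dist (repr (ultralimit_pi x)) x = 0.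
Proof. by apply/eqP; have /eqmodP := @reprK _ _ (ultralimit_pi x). Qed.

(** The distance of the ultralimit is computed on canonical representatives; this allows any
    representatives to be used. *)
Lemma ultralimit_dist_pi x y :
  mdist (ultralimit_pi x) (ultralimit_pi y) = ultraseq_dist x y.
Proof.
have H (u v u' v' : ultraseq w b d) : ultraseq_dist u u' = 0 ->
  ultraseq_dist v v' = 0 ->
    ultraseq_dist u v <= ultraseq_dist u' v'.
  move=> uu' vv'; apply: le_trans (ultraseq_dist_triangle u' _ _) _.
  rewrite uu' add0r; apply: le_trans (ultraseq_dist_triangle v' _ _) _.
  by rewrite (ultraseq_dist_sym v') vv' addr0.
apply/le_anti/andP; split; apply: H; rewrite ?ultraseq_dist_repr //.
  by rewrite ultraseq_dist_sym ultraseq_dist_repr.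
by rewrite ultraseq_dist_sym ultraseq_dist_repr.
Qed.

End OneSpace.

Section TwoSpaces.
Variable d : nat -> {posnum R}.
Hypothesis d_oo : (fun i => (d i)%:num) @ \oo --> +oo.
Variables (X Y : nat -> metricType R).
Variables (a : forall i, X i) (b : forall i, Y i).

Lemma scale_cvg0 (C : R) : (fun i => C / (d i)%:num) @ ultra_sets w --> (0 : R).
Proof.
rewrite -(mulr0 C); apply: cvgM; first exact: cvg_cst.
apply: cvg_trans; first exact: (cvg_app _ nonprincipal_cofinite).
by apply/gtr0_cvgV0 => //; apply: nearW.
Qed.

(** The additive error vanishes after rescaling, so coarse Lipschitz estimates become Lipschitz ones
    in the limit. *)
Lemma ultraseq_dist_le (x x' : ultraseq w a d) (y y' : ultraseq w b d)
    (L C : R) :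
  (forall i, mdist (y i) (y' i) <= L * mdist (x i) (x' i) + C) ->
  ultraseq_dist y y' <= L * ultraseq_dist x x'.
Proof.
move=> yx; rewrite -[L * _]addr0.
apply: (ler_cvg_to (@ultraseq_dist_cvg _ _ _ _ _ y y')
  (cvgD (cvgM (cvg_cst L) (@ultraseq_dist_cvg _ _ _ _ _ x x')) (scale_cvg0 C))).
apply: nearW => i; have := yx i.
by rewrite -(ler_pM2r (x := (d i)%:num^-1)) // mulrDl -mulrA.
Qed.

Lemma ultraseq_bound (x : ultraseq w a d) (y : forall i, Y i) (L C : R) :
  0 <= L -> (forall i, mdist (y i) (b i) <= L * mdist (x i) (a i) + C) ->
  exists M : R, \forall i \near ultra_sets w,
    mdist (y i) (b i) / (d i)%:num <= M.
Proof.
move=> L0 yx; have [M xM] := ultraseq_bounded x; exists (L * M + 1).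
have C1 : \forall i \near ultra_sets w, C / (d i)%:num <= 1.
  by apply: (cvgr_le _ (@scale_cvg0 C)); lra.
apply: filterS2 xM C1 => i xM C1.
have := yx i; rewrite -(ler_pM2r (x := (d i)%:num^-1)) // mulrDl -mulrA.
have := ler_wpM2l L0 xM; lra.
Qed.

End TwoSpaces.
End UltraseqTheory.

Section CutPoints.
Context {R : realType}.

(** By injectivity and surjectivity the complement of [f x] is the image of the complement of [x],
    and a continuous image of a connected set is connected. *)
Lemma bilipschitz_cut_point (X Y : metricType R) (K : R) (f : X -> Y) (x : X) :
  1 <= K ->
  (forall p p', mdist (f p) (f p') <= K * mdist p p') ->
  (forall p p', mdist p p' <= K * mdist (f p) (f p')) ->
  (forall y, exists p, f p = y) ->
  cut_point (f x) -> cut_point x.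
Proof.
move=> K1 fu fl fs cfx cx; apply: cfx.
have finj p p' : f p = f p' -> p = p'.
  move=> fpp'; apply: mdist_positivity; apply/le_anti; rewrite mdist_ge0 andbT.
  by have := fl p p'; rewrite fpp' mdistxx mulr0.
have -> : ~` [set f x] = f @` (~` [set x]).
  apply/seteqP; split=> [y /= yx|_ [p /= px <-] /finj //].
  by have [p py] := fs y; exists p => //= px; apply: yx; rewrite -py px.
apply: connected_continuous_connected => //; apply: continuous_subspaceT => p.
apply/cvg_ballP => e e0; have eK : 0 < e / K by rewrite divr_gt0 //; lra.
apply: filterS (nbhsx_ballx p _ eK) => p'; rewrite !ballEmdist /= => pp'.
apply: le_lt_trans (fu p p') _; rewrite mulrC -ltr_pdivlMr //; lra.
Qed.

End CutPoints.

(** * Quasi-isometry invariance of thickness *)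

Section ThickTransfer.
Context {R : realType}.
Variables (X Y : metricType R) (K : R) (q : X -> Y).
Hypothesis qK : quasi_isometry_const K q.

(** Applying [q] termwise induces a bi-Lipschitz map of ultralimits. It is onto because a termwise
    choice of near-preimages inverts it up to an error that rescaling kills. *)
Lemma ultralimit_cut_point_transfer (w : nonprincipal_ultrafilter)
    (d : nat -> {posnum R}) (a : nat -> X) (b : nat -> Y) :
  (fun i => (d i)%:num) @ \oo --> +oo ->
  (forall i, mdist (q (a i)) (b i) <= K) ->
  (forall x : ultralimit w (Y := fun=> X) a d, ~ cut_point x) ->
  forall y : ultralimit w (Y := fun=> Y) b d, ~ cut_point y.
Proof.
move=> d_oo ab ncX; have [K1 qu ql /choice[p pK]] := qK.
have KV u : mdist (q (p u)) u <= K by apply: pK.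
have pushP (x : ultraseq w (Y := fun=> X) a d) : exists M : R,
    \forall i \near ultra_sets w, mdist (q (x i)) (b i) / (d i)%:num <= M.
  apply: (ultraseq_bound (w := w) d_oo (L := K) (C := 2 * K) (x := x)).
    lra.
  move=> i; apply: le_trans (metric_triangle _ (q (a i)) _) _.
  by have := qu (x i) (a i); have := ab i; lra.
pose push x : ultraseq w (Y := fun=> Y) b d := Ultraseq (pushP x).
have pullP (y : ultraseq w (Y := fun=> Y) b d) : exists M : R,
    \forall i \near ultra_sets w, mdist (p (y i)) (a i) / (d i)%:num <= M.
  apply: (ultraseq_bound (w := w) d_oo (L := K) (C := K * (2 * K) + K)
    (x := y)).
    lra.
  move=> i; have := matched_dist qK (pK (y i)) (ab i); lra.
pose pull y : ultraseq w (Y := fun=> X) a d := Ultraseq (pullP y).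
pose f (x : ultralimit w (Y := fun=> X) a d) :
    ultralimit w (Y := fun=> Y) b d :=
  ultralimit_pi (push (repr (x : {eq_quot ultraseq_equiv w a d}%qT))).
have fu x x' : mdist (f x) (f x') <= K * mdist x x'.
  by rewrite ultralimit_dist_pi; apply: (ultraseq_dist_le d_oo (C := K)) => i;
    apply: qu.
have fl x x' : mdist x x' <= K * mdist (f x) (f x').
  by rewrite ultralimit_dist_pi; apply: (ultraseq_dist_le d_oo (C := K)) => i;
    apply: ql.
have push0 x x' : ultraseq_dist x x' = 0 ->
  ultraseq_dist (push x) (push x') = 0.
  move=> xx'; apply/le_anti; rewrite ultraseq_dist_ge0 andbT -(mulr0 K) -xx'.
  by apply: (ultraseq_dist_le d_oo (C := K)) => i; apply: qu.
have fs y : exists x, f x = y.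
  pose y' := repr (y : {eq_quot ultraseq_equiv w b d}%qT).
  exists (ultralimit_pi (pull y')).
  have -> : y = ultralimit_pi y'.
    exact/esym/(@reprK _ {eq_quot ultraseq_equiv w b d}%qT).
  apply: mdist_positivity; rewrite ultralimit_dist_pi; apply/le_anti.
  rewrite ultraseq_dist_ge0 andbT.
  apply: le_trans (ultraseq_dist_triangle (push (pull y')) _ _) _.
  (* The termwise distance is at most [K], so the estimate applies with multiplicative constant 0
     and the limit distance vanishes. *)
  rewrite push0 ?ultraseq_dist_repr // add0r -(mul0r (ultraseq_dist y' y')).
  by apply: (ultraseq_dist_le d_oo (C := K)) => i; rewrite mul0r add0r;
    apply: pK.
move=> y cy; have [x xy] := fs y; apply: (ncX x).
by apply: bilipschitz_cut_point K1 fu fl fs _; rewrite xy.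
Qed.

Lemma thick0_transfer : thick0 X -> thick0 Y.
Proof.
have [K1 qu ql qs] := qK; have K0 : 0 < K by lra.
move=> [[L [C [c [L1 C0 c0 hX]]]] hcone]; split.
  (* The first two are the constants of [q \o f]. In the third, the extra 1 replaces the infimum by
     a point of the quasi-geodesic, and [2 * K] pays for the error of [q] and for the distance from
     [y] to the image of [x]. *)
  exists (K * L), (K * C + K), (K * (c + 1) + 2 * K).
  split; [nra|nra|nra|move=> _ -> y].
  have [x xy] := qs y; have [f fqg fx] := hX X erefl x.
  exists (q \o f).
    move=> s t; have /andP[fl fu] := fqg s t; apply/andP; split; last first.
      by have := qu (f s) (f t); rewrite /=; nra.
    have := ql (f s) (f t); rewrite /= => qfl.
    have : (`|s - t| / L - C - K) / K <= mdist (q (f s)) (q (f t)).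
      by rewrite ler_pdivrMr //; lra.
    apply: le_trans; rewrite !mulrBl divff ?gt_eqF // invfM mulrA mulrAC -addrA
      lerD2l.
    rewrite -opprD lerN2; have : C / K <= K * C; last by lra.
    by rewrite ler_pdivrMr // mulrAC ler_peMl //; nra.
  have c1 : c < c + 1 by lra.
  have [_ [s _ <-] xs] := nbhd_tube c1 fx.
  apply: tube_nbhd; exists (q (f s)); first by exists s.
  rewrite metric_sym in xy; apply: le_trans (metric_triangle _ (q x) _) _.
  have := qu x (f s); have : K * mdist x (f s) <= K * (c + 1).
    by rewrite ler_pM2l.
  lra.
move=> Ys YsY; have E : Ys = fun=> Y by apply/funext.
subst Ys; have [w [d [d_oo ncX]]] := hcone (fun=> X) (fun=> erefl).
exists w, d; split=> // b.
(* The ultrafilter and scaling found for [X] work for all its basepoints, hence for near-preimages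
   of the given [b]. *)
have /choice[a ab] : forall i, exists x, mdist (q x) (b i) <= K.
  by move=> i; apply: qs.
exact: ultralimit_cut_point_transfer d_oo ab (ncX a).
Qed.

(** Restrict [q] to [C] and move each value by at most [K] into [D]. Subspace distances are those of
    the ambient spaces, so the estimates for matched points apply. *)
Lemma matched_subspace C D : matched K q C D ->
  exists (K' : R) (f : set_type C -> set_type D), quasi_isometry_const K' f.
Proof.
move=> [CD DC]; have [K1 qu ql qs] := qK.
have /choice[f fP] : forall c : set_type C, exists d : set_type D,
    mdist (q (\val c)) (\val d) <= K.
  by move=> [c Cc]; have [d Dd cd] := CD c (set_mem Cc);
    exists (SigSub (mem_set Dd)).
have distE (Z : metricType R) (S : set Z) (s t : set_type S) :
  mdist s t = mdist (\val s) (\val t) by [].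
exists (2 * K ^+ 2 + 3 * K), f; split=> [|c c'|c c'|d].
- nra.
- have := matched_dist_image qK (fP c) (fP c'); rewrite !distE.
  have := mdist_ge0 (\val c) (\val c'); nra.
- have := matched_dist qK (fP c) (fP c'); rewrite !distE.
  have := mdist_ge0 (\val (f c)) (\val (f c')); nra.
- have [c Cc cd] := DC _ (set_mem (valP d)); exists (SigSub (mem_set Cc)).
  rewrite distE; apply: le_trans (metric_triangle _ (q c) _) _.
  have := fP (SigSub (mem_set Cc)); rewrite /= metric_sym; nra.
Qed.

End ThickTransfer.

Lemma thick_of_order1_transfer (R : realType) (A B : group_pair) (K : R)
    (q : cayley R A -> cayley R B) :
  pair_quasi_isometry K q -> thick_of_order1 R A -> thick_of_order1 R B.
Proof.
move=> qK [[/(tau_network_transfer qK) netB thA] nA]; have [q' _ qD] := qK.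
split; first split=> // D DD.
  have [C CC CD] := qD D DD; have [K' [f fK']] := matched_subspace q' CD.
  exact: thick0_transfer fK' (thA C CC).
(* Failure of thickness of order 0 passes from [A] to [B] because such thickness would come back
   along a quasi-inverse. *)
have [K' [p pK']] := quasi_isometry_inverse q'.
by move=> /(thick0_transfer pK').
Qed.

Theorem theorem1p5 (R : realType) :
  geometric_property R finite_height /\
  geometric_property R finite_width /\
  geometric_property R (fenced_infinite_intersections R) /\
  geometric_property R almost_malnormal /\
  geometric_property R (network R) /\
  geometric_property R (thick_of_order1 R) /\
  geometric_property R self_commensurating /\
  geometric_property R finite_index_in_commensurator /\
  geometric_property R (bounded_packing R) /\
  geometric_property R finite_packing.
Proof.
split; first exact: geometric_propertyI (@finite_height_transfer R).
split; first exact: geometric_propertyI (@finite_width_transfer R).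
split; first exact: geometric_propertyI (@fenced_transfer R).
split; first exact: almost_malnormal_geometric.
split; first exact: geometric_propertyI (@network_transfer R).
split; first exact: geometric_propertyI (@thick_of_order1_transfer R).
split; first exact: self_commensurating_geometric.
split; first exact: geometric_propertyI
  (@finite_index_in_commensurator_transfer R).
split; first exact: geometric_propertyI (@bounded_packing_transfer R).
exact: geometric_propertyI (@finite_packing_transfer R).
Qed.
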